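(* Let $d \geq 2$. There exist constants $C_d, \varrho_d > 0$, depending only on $d$, such that for every $\varrho \in (0, \varrho_d]$ there exist Borel probability measures $\mu, \nu$ supported on the closed Euclidean unit ball $B_1 \subset \mathbb{R}^d$ satisfying $$W_1(\mu,\nu) \geq \varrho \qquad\text{and}\qquad \tilde W_{1,1}(\mu,\nu) \leq C_d\, \varrho^{1+d/2}.$$ In particular, if for some $R>0$, $\beta>0$ and some finite constant $C'$ (which may depend on $d$ and $R$) the inequality $W_1(\mu,\nu) \leq C'\, \tilde W_{1,1}(\mu,\nu)^{\beta}$ holds for all Borel probability measures $\mu,\nu$ supported on the closed ball $B_R\subset\mathbb{R}^d$, then $\beta \leq \frac{2}{d+2}$.
   Context: $B_R$ denotes the closed Euclidean ball of radius $R$ centered at the origin in $\mathbb{R}^d$. For probability measures $\mu,\nu$ on $\mathbb{R}^n$ with finite first moment, $W_1(\mu,\nu) := \inf_{\gamma\in\Gamma(\mu,\nu)} \int \|x-y\|\,d\gamma(x,y)$, where $\Gamma(\mu,\nu)$ is the set of couplings of $\mu$ and $\nu$ and $\|\cdot\|$ is the Euclidean norm. The max-sliced 1-Wasserstein distance on $\mathbb{R}^d$ is $$\tilde W_{1,1}(\mu,\nu) := \max_{\theta\in\mathbb{S}^{d-1}} W_1(\theta_\#\mu,\theta_\#\nu),$$ where $\theta_\#\mu$ denotes the pushforward of $\mu$ under the map $x\mapsto\langle\theta,x\rangle$, a probability measure on $\mathbb{R}$. *)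

(* Defs.v *)
From HB Require Import structures.
From mathcomp Require Import all_boot all_order all_algebra.
From mathcomp Require Import all_classical all_reals all_analysis.
From mathcomp Require Import measurable_realfun.

Set Implicit Arguments.
Unset Strict Implicit.
Unset Printing Implicit Defensive.

Import Order.TTheory GRing.Theory Num.Theory.
Import numFieldTopology.Exports numFieldNormedType.Exports.

Local Open Scope classical_set_scope.
Local Open Scope ring_scope.

Definition dotp (R : realType) (d : nat) (x y : 'rV[R]_d) : R :=
  \sum_(i < d) x ord0 i * y ord0 i.

(* The library norm on 'rV[R]_d is the sup norm, hence this separate one. *)
Definition enorm (R : realType) (d : nat) (x : 'rV[R]_d) : R :=
  Num.sqrt (dotp x x).

Definition ecball (R : realType) (d : nat) (r : R) : set 'rV[R]_d :=
  [set x | enorm x <= r].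

Definition esphere (R : realType) (d : nat) : set 'rV[R]_d :=
  [set theta | enorm theta = 1].

(* R^d with its Borel sigma-algebra. The library topology on 'rV[R]_d is the
   product one, whose open sets are those of the Euclidean norm. *)
Notation borel_rV R d := (g_sigma_algebraType (@open 'rV[R]_d)).

(* The marginal conditions are restricted to measurable sets, because the value
   of a library measure on a non-measurable set is unconstrained. *)
Definition couplings (disp : measure_display) (T : measurableType disp)
    (R : realType) (mu nu : probability T R) :
    set (probability (T * T)%type R) :=
  [set gamma | (forall A, measurable A -> gamma (A `*` setT) = mu A) /\
               (forall A, measurable A -> gamma (setT `*` A) = nu A)].

Definition wasserstein1 (disp : measure_display) (T : measurableType disp)
    (R : realType) (dist : T -> T -> R) (mu nu : probability T R) : \bar R :=
  ereal_inf [set (\int[gamma]_z (dist z.1 z.2)%:E)%E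
            | gamma in couplings mu nu].

Definition W1 (R : realType) (d : nat)
    (mu nu : probability (borel_rV R d) R) : \bar R :=
  wasserstein1 (fun x y : borel_rV R d => enorm ((x : 'rV[R]_d) - y)) mu nu.

Definition W1_line (R : realType)
    (mu nu : probability R R) : \bar R :=
  wasserstein1 (fun x y : R => `|x - y|) mu nu.

Definition slice (R : realType) (d : nat) (theta : 'rV[R]_d)
    (x : borel_rV R d) : R := dotp theta x.

Lemma measurable_slice (R : realType) (d : nat) (theta : 'rV[R]_d) :
  measurable_fun [set: borel_rV R d] (slice theta).
Proof.
apply: (measurability _ (RGenOpens.measurableE R)).
move=> _ [_ [a [b ->] <-]]; rewrite setTI; apply: sub_sigma_algebra.
have cf : continuous (fun x : 'rV[R]_d => dotp theta x).
  apply: continuous_big; first exact: add_continuous.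
  by move=> i _ x; apply: cvgMl_tmp; [exact: nbhs_filter|exact: coord_continuous].
by move/continuousP : cf; apply; exact: interval_open.
Qed.

HB.instance Definition _ (R : realType) (d : nat) (theta : 'rV[R]_d) :=
  isMeasurableFun.Build _ _ _ _ (slice theta) (measurable_slice theta).

(* [distribution mu (slice theta)] is the pushforward of mu under
   x |-> <theta, x>. The supremum is attained when d >= 1 and mu and nu have
   finite first moments. *)
Definition max_sliced_W1 (R : realType) (d : nat)
    (mu nu : probability (borel_rV R d) R) : \bar R :=
  ereal_sup [set W1_line (distribution mu (slice theta))
                         (distribution nu (slice theta))
            | theta in @esphere R d].

(* A closed set contains the support of mu iff it has full measure. *)
Definition supported_on (disp : measure_display) (T : measurableType disp)
    (R : realType) (mu : probability T R) (A : set T) : Prop :=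
  mu A = 1%E.

(* Main.v *)
Require Import Defs.
From HB Require Import structures.
From mathcomp Require Import all_boot all_order all_algebra.
From mathcomp Require Import all_classical all_reals all_analysis.
From mathcomp Require Import measurable_realfun.
From mathcomp Require Import ring lra zify.

Set Implicit Arguments.
Unset Strict Implicit.
Unset Printing Implicit Defensive.

Import Order.TTheory GRing.Theory Num.Theory.
Import numFieldTopology.Exports numFieldNormedType.Exports.

Local Open Scope classical_set_scope.
Local Open Scope ring_scope.

(** The measures are supported on a lattice and their difference is a random
    signed sum of "plates": for each slope [b / n] in a net of about [n^(d-1)]
    directions, a plate is a tent function on a hyperplane of that slope,
    smeared over the thickness [1/n] and differenced [2(d-1)+1] times across
    the plate with step [1/n].

    Projecting a plate on a direction [theta], summation by parts moves two
    differences on the tent in each of the [d-1] horizontal coordinates, which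
    gives a gain of [prod_i max(1, |n theta_i / theta_0 + b_i|)^-2].  These
    factors are summable over [b] uniformly in [theta], so that all the plates
    together contribute to a slice no more than boundedly many of them do.  No
    cancellation between the signs is used here.

    For the lower bound, every point lies on about [n^(d-2)] plates, so that by
    Khintchine's inequality the sum of the plates over random signs has size
    [n^((d-2)/2)] at scale [1/n], both in total variation and when tested
    against bumps of radius [1/n].  Normalising the total variation to [1], the
    distance [W1] is of order [1/n] and the slices are of order [n^-(1+d/2)]. *)

(** Two differences per horizontal coordinate are needed because a single one would only gain
    [1 / |tau + b|], whose sum over [b] loses a logarithm for each coordinate. The extra difference
    is spent on the test function: a 1-Lipschitz [g] need not be bounded, while its difference
    across a thickness [1/n] is at most [1/n]. On a finite lattice every integral is a finite sum
    and the optimal coupling of two slices is explicit; the price is that a shift has to be rounded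
    to a multiple of a lattice step. The rounding error is of the order of the mesh for each of the
    [n^(d-1)] plates, so the mesh is taken at most [n^-d]. In common units the slices are of order
    [1/n] and the total variation of order [n * n^((d-2)/2)]; their quotient is the exponent. Since
    the measures are normalised by the total variation of the random sum, one choice of signs must
    bound the pairing with the bumps from below relative to that very quantity. *)

Definition fcons (A : Type) (m : nat) (a : A) (f : {ffun 'I_m -> A}) :
    {ffun 'I_m.+1 -> A} :=
  [ffun i => if unlift ord0 i is Some j then f j else a].

Lemma fcons0 (A : Type) m (a : A) (f : {ffun 'I_m -> A}) : fcons a f ord0 = a.
Proof. by rewrite ffunE unlift_none. Qed.

Lemma fconsS (A : Type) m (a : A) (f : {ffun 'I_m -> A}) i :
  fcons a f (lift ord0 i) = f i.
Proof. by rewrite ffunE liftK. Qed.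

Lemma sum_fcons (V : nmodType) (A : finType) m (F : {ffun 'I_m.+1 -> A} -> V) :
  \sum_f F f = \sum_(f : {ffun 'I_m -> A}) \sum_a F (fcons a f).
Proof.
rewrite exchange_big pair_bigA /=.
rewrite (reindex (fun p : A * {ffun 'I_m -> A} => fcons p.1 p.2)) //=.
exists (fun f => (f ord0, [ffun i => f (lift ord0 i)])) => [[a f] _|f _] /=.
  rewrite fcons0; congr (_, _); apply/ffunP => i; by rewrite ffunE fconsS.
by apply/ffunP => i; case: (unliftP ord0 i) => [j ->|->]; rewrite ?fcons0 ?fconsS ?ffunE.
Qed.

(** * Moments of sums with random signs *)

Section Rademacher.
Variables (R : realFieldType) (J : eqType).
Implicit Types (s : seq J) (e a : J -> R).

Definition upd e j v : J -> R := fun i => if i == j then v else e i.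

(** The expectation over independent uniform signs indexed by [s], as a recursion, so that moments
    are computed by induction on [s]. Indices outside [s] receive the value 0. *)
Fixpoint sign_avg s (F : (J -> R) -> R) : R :=
  if s is j :: s' then
    (sign_avg s' (fun e => F (upd e j 1)) + sign_avg s' (fun e => F (upd e j (- 1)))) / 2
  else F (fun=> 0).

Lemma sign_avg_ext s F G : (forall e, F e = G e) -> sign_avg s F = sign_avg s G.
Proof.
elim: s F G => [|j s IH] F G FG /=; first exact: FG.
by congr ((_ + _) / _); apply: IH => e; exact: FG.
Qed.

Lemma sign_avgD s F G : sign_avg s (fun e => F e + G e) = sign_avg s F + sign_avg s G.
Proof. by elim: s F G => [|j s IH] F G //=; rewrite !IH; field. Qed.

Lemma sign_avgZ s c F : sign_avg s (fun e => c * F e) = c * sign_avg s F.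
Proof. by elim: s F => [|j s IH] F //=; rewrite !IH; field. Qed.

Lemma sign_avg_sum (I : Type) (r : seq I) s (F : I -> (J -> R) -> R) :
  sign_avg s (fun e => \sum_(i <- r) F i e) = \sum_(i <- r) sign_avg s (F i).
Proof.
elim: r => [|i r IH].
  rewrite big_nil (@sign_avg_ext _ _ (fun e => 0 * 0)); last first.
    by move=> e; rewrite big_nil mulr0.
  by rewrite (sign_avgZ s 0 (fun=> 0)) mul0r.
by rewrite big_cons -IH -sign_avgD; apply: sign_avg_ext => e; rewrite big_cons.
Qed.

Lemma sign_avg_le_witness s F : exists2 e, (forall j, `|e j| <= 1) & sign_avg s F <= F e.
Proof.
suff [e He HF] : exists2 e, (forall j, e j = 0 \/ `|e j| = 1) & sign_avg s F <= F e.
  by exists e => // j; case: (He j) => ->; rewrite ?normr0.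
elim: s F => [|j s IH] F /=; first by exists (fun=> 0); [left|].
have [e1 He1 H1] := IH (fun e => F (upd e j 1)).
have [e2 He2 H2] := IH (fun e => F (upd e j (- 1))).
have [H|H] := leP (F (upd e1 j 1)) (F (upd e2 j (- 1))).
  exists (upd e2 j (- 1)); last by lra.
  by move=> i; rewrite /upd; case: ifP => // _; right; rewrite normrN1.
exists (upd e1 j 1); last by lra.
by move=> i; rewrite /upd; case: ifP => // _; right; rewrite normr1.
Qed.

Definition lin s a e := \sum_(i <- s) e i * a i.

Lemma lin_upd s a e j v : j \notin s -> lin (j :: s) a (upd e j v) = v * a j + lin s a e.
Proof.
move=> js; rewrite /lin big_cons /upd eqxx; congr (_ + _).
by rewrite !big_seq; apply: eq_bigr => i si; case: eqP => // ij; rewrite -ij si in js.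
Qed.

Lemma sign_avg_lin2 s a x : uniq s ->
  sign_avg s (fun e => (x + lin s a e) ^+ 2) = x ^+ 2 + \sum_(i <- s) a i ^+ 2.
Proof.
elim: s x => [|j s IH] x /=; first by rewrite /lin !big_nil !addr0.
case/andP => js us; rewrite big_cons.
under sign_avg_ext do rewrite lin_upd // addrA.
under [X in _ + X]sign_avg_ext do rewrite lin_upd // addrA.
by rewrite !IH //; field.
Qed.

(** The bound is the fourth moment of [x] plus a centered Gaussian of variance [\sum a i ^+ 2]. The
    shift [x] is carried along because fixing the sign of [j] turns it into [x + a j] or [x - a j];
    each step loses [2 * a j ^+ 4], the gap between the Gaussian and the sign. *)
Lemma sign_avg_lin4 s a x : uniq s ->
  sign_avg s (fun e => (x + lin s a e) ^+ 4) <=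
  x ^+ 4 + 6 * x ^+ 2 * (\sum_(i <- s) a i ^+ 2) + 3 * (\sum_(i <- s) a i ^+ 2) ^+ 2.
Proof.
elim: s x => [|j s IH] x /=; first by rewrite /lin !big_nil; lra.
case/andP => js us; rewrite big_cons.
under sign_avg_ext do rewrite lin_upd // addrA.
under [X in _ + X]sign_avg_ext do rewrite lin_upd // addrA.
have := IH (x + 1 * a j) us; have := IH (x + -1 * a j) us.
set V := \sum_(i <- s) a i ^+ 2; set p := sign_avg _ _; set q := sign_avg _ _.
move=> H1 H2.
have V0 : 0 <= a j ^+ 2 * V by apply: mulr_ge0 (sqr_ge0 _) (sumr_ge0 _ _) => i _; exact: sqr_ge0.
have A4 : 0 <= a j ^+ 4 by exact: exprn_even_ge0.
have -> : x ^+ 4 + 6 * x ^+ 2 * (a j ^+ 2 + V) + 3 * (a j ^+ 2 + V) ^+ 2 =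
  (((x + -1 * a j) ^+ 4 + 6 * (x + -1 * a j) ^+ 2 * V + 3 * V ^+ 2) +
  ((x + 1 * a j) ^+ 4 + 6 * (x + 1 * a j) ^+ 2 * V + 3 * V ^+ 2)) / 2 + 2 * a j ^+ 4.
  by field.
lra.
Qed.

End Rademacher.

(** * Finite differences along progressions *)

Section Differences.
Variable R : archiRealFieldType.
Implicit Types (G g : R -> R) (s h x B L rho : R).

Lemma norm_sum_le (T : finType) (F : T -> R) B :
  (forall i, `|F i| <= B) -> `|\sum_i F i| <= #|T|%:R * B.
Proof.
move=> HB; apply: (le_trans (ler_norm_sum _ _ _)).
by apply: (le_trans (ler_sum _ (fun i _ => HB i))); rewrite sumr_const mulr_natl.
Qed.

Definition diff_by s g : R -> R := fun x => g x - g (x + s).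

Lemma iter_diff_by k s g x :
  iter k (diff_by s) g x =
  \sum_(q < k.+1) (-1) ^+ q * 'C(k, q)%:R * g (x + q%:R * s).
Proof.
elim: k x => [|k IH] x.
  by rewrite big_ord1 /= bin0 expr0 !mul1r mul0r addr0.
rewrite iterS /diff_by !IH -/(diff_by s).
rewrite [RHS]big_ord_recl /= bin0 expr0 !mul1r mul0r addr0.
under [X in _ = _ + X]eq_bigr => q _.
  rewrite /bump /= add1n binS natrD mulrDr mulrDl exprS mulN1r.
  over.
rewrite /= big_split /= [X in _ = _ + (X + _)]big_ord_recr /= bin_small // mulr0 mul0r addr0.
rewrite addrA; congr (_ + _).
  rewrite big_ord_recl /= bin0 expr0 !mul1r mul0r addr0; congr (_ + _).
  by apply: eq_bigr => q _; rewrite /bump /= add1n exprS mulN1r.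
rewrite -sumrN; apply: eq_bigr => q _.
by rewrite !mulNr -natr1; congr (- (_ * g _)); ring.
Qed.

Lemma iter_diff_by_sum (T : finType) k s g (t : T -> R) x :
  iter k (diff_by s) (fun y => \sum_a g (y + t a)) x =
  \sum_a iter k (diff_by s) g (x + t a).
Proof.
elim: k x => [//|k IH] x.
rewrite !iterS /diff_by -/(diff_by s) !IH -sumrB; apply: eq_bigr => a _.
by rewrite -/(diff_by s) addrAC.
Qed.

Definition bounded_lip G B L :=
  (forall x, `|G x| <= B) /\ (forall x y, `|G x - G y| <= L * `|x - y|).

Lemma bounded_lip_ge0 G B L : bounded_lip G B L -> 0 <= B /\ 0 <= L.
Proof.
move=> [HB HL]; split; first exact: le_trans (HB 0).
by have := HL 1 0; rewrite subr0 normr1 mulr1; apply: le_trans.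
Qed.

Lemma bounded_lip_diff_by G B L s : bounded_lip G B L ->
  bounded_lip (diff_by s G) (2 * B) (2 * L).
Proof.
move=> [HB HL]; split => [x|x y]; rewrite /diff_by.
  apply: (le_trans (ler_normB _ _)); have := HB x; have := HB (x + s); lra.
have := HL x y; have := HL (x + s) (y + s).
have -> : x + s - (y + s) = x - y by ring.
move=> h2 h1.
rewrite (_ : _ - _ = (G x - G y) - (G (x + s) - G (y + s))); last by ring.
apply: (le_trans (ler_normB _ _)); lra.
Qed.

Lemma bounded_lip_sum (T : finType) G B L (t : T -> R) : bounded_lip G B L ->
  bounded_lip (fun x => \sum_a G (x + t a)) (#|T|%:R * B) (#|T|%:R * L).
Proof.
move=> [HB HL]; split => [x|x y].
  exact: norm_sum_le.
rewrite -sumrB -mulrA; apply: norm_sum_le => a.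
by apply: le_trans (HL _ _) _; rewrite opprD addrACA subrr addr0.
Qed.

(** The two progressions differ by [q] terms at either end. Splitting the range [M + q] in both
    orders gives this also when [q] exceeds [M]. *)
Lemma progression_shift_le G B h (M q : nat) x : (forall y, `|G y| <= B) ->
  `|\sum_(u < M) (G (x + u%:R * h) - G (x + u%:R * h + q%:R * h))| <=
  q%:R * (2 * B).
Proof.
move=> HB.
have -> : \sum_(u < M) (G (x + u%:R * h) - G (x + u%:R * h + q%:R * h)) =
  \sum_(u < q) (G (x + u%:R * h) - G (x + (M + u)%:R * h)).
  rewrite !sumrB; apply/eqP; rewrite subr_eq addrAC eq_sym subr_eq eq_sym; apply/eqP.
  have E1 := @big_split_ord R 0 +%R M q predT (fun i => G (x + i%:R * h)).
  have E2 := @big_split_ord R 0 +%R q M predT (fun i => G (x + i%:R * h)).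
  rewrite /= in E1 E2.
  rewrite -{}E1 addnC {}E2; congr (_ + _); apply: eq_bigr => u _.
  by rewrite natrD mulrDl addrA [in RHS]addrAC.
rewrite -[X in X%:R * (2 * _)]card_ord; apply: norm_sum_le => u.
apply: (le_trans (ler_normB _ _)).
by have := HB (x + u%:R * h); have := HB (x + (M + u)%:R * h); lra.
Qed.

(* Replacing the shift [s] by the nearest multiple of [h] costs [`|h| * L] per
   term; afterwards the sum over the progression telescopes. *)
Lemma sum_dif_le G B L (M : nat) h s rho : bounded_lip G B L -> 0 <= rho ->
  2 <= rho \/ 2 * `|s| <= rho * (M%:R * `|h|) ->
  forall x, `|\sum_(u < M) diff_by s G (x + u%:R * h)| <= M%:R * (rho * B + `|h| * L).
Proof.
move=> HG rho0 Hrho x; have [B0 L0] := bounded_lip_ge0 HG; case: (HG) => [HB HL].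
have hL0 : 0 <= `|h| * L by rewrite mulr_ge0.
case: Hrho => [rho2|Hrho].
  rewrite -[X in X%:R * (_ + _)]card_ord; apply: norm_sum_le => u.
  have [/(_ (x + u%:R * h)) H _] := bounded_lip_diff_by s HG.
  apply: (le_trans H); have : 2 * B <= rho * B by rewrite ler_wpM2r.
  lra.
have [h0|hn0] := eqVneq h 0.
  have s0 : s = 0.
    by apply/eqP; rewrite -normr_le0; move: Hrho; rewrite h0 normr0; lra.
  rewrite big1 ?normr0 ?mulr_ge0 ?addr_ge0 ?mulr_ge0 // => u _.
  by rewrite /diff_by s0 addr0 subrr.
have hp : 0 < `|h| by rewrite normr_gt0.
have [q Hq] : exists q : nat, q%:R * `|h| <= `|s| < q.+1%:R * `|h|.
  exists (Num.truncn (`|s| / `|h|)).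
  have := @truncn_itv R (`|s| / `|h|); rewrite divr_ge0 // => /(_ isT).
  by rewrite ler_pdivlMr // ltr_pdivrMr.
case/andP: Hq => Hq1 Hq2.
have Hq3 : q%:R * 2 <= rho * M%:R.
  rewrite -(ler_pM2r hp) -!mulrA; apply: le_trans _ Hrho.
  by rewrite mulrCA ler_pM2l // ler_pM2l.
have key s' : `|s - s'| <= `|h| ->
   `|\sum_(u < M) (G (x + u%:R * h) - G (x + u%:R * h + s'))| <= q%:R * (2 * B) ->
   `|\sum_(u < M) diff_by s G (x + u%:R * h)| <= M%:R * (rho * B + `|h| * L).
  move=> Hs Hsum.
  have -> : \sum_(u < M) diff_by s G (x + u%:R * h) =
    \sum_(u < M) (G (x + u%:R * h) - G (x + u%:R * h + s')) +
    \sum_(u < M) (G (x + u%:R * h + s') - G (x + u%:R * h + s)).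
    by rewrite -big_split /=; apply: eq_bigr => u _; rewrite addrA subrK.
  apply: (le_trans (ler_normD _ _)).
  rewrite mulrDr; apply: lerD.
    apply: (le_trans Hsum); rewrite mulrA [leRHS]mulrA ler_wpM2r //.
    by rewrite [leRHS]mulrC.
  rewrite -[X in X%:R * (`|h| * L)]card_ord; apply: norm_sum_le => u.
  apply: (le_trans (HL _ _)); rewrite opprD addrACA subrr add0r distrC.
  by rewrite mulrC ler_wpM2r.
have nat1 : q.+1%:R = q%:R + 1 :> R by rewrite natr1.
rewrite nat1 mulrDl mul1r in Hq2.
have [sh|sh] : s / h = `|s| / `|h| \/ s / h = - (`|s| / `|h|).
  rewrite -normf_div; case: (ger0P (s / h)) => H; [by left|right].
  by rewrite opprK.
- apply: (key (q%:R * h)); last exact: progression_shift_le.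
  have -> : s = `|s| / `|h| * h by rewrite -sh divfK.
  rewrite -mulrBl normrM.
  have -> : `|s| / `|h| - q%:R = (`|s| - q%:R * `|h|) / `|h|.
    by rewrite mulrBl mulfK // gt_eqF.
  rewrite normf_div normr_id divfK ?gt_eqF // ger0_norm; lra.
- apply: (key (- (q%:R * h))).
    have -> : s = - (`|s| / `|h|) * h by rewrite -sh divfK.
    rewrite opprK mulNr addrC -mulrBl normrM.
    have -> : q%:R - `|s| / `|h| = (q%:R * `|h| - `|s|) / `|h|.
      by rewrite mulrBl mulfK // gt_eqF.
    rewrite normf_div normr_id divfK ?gt_eqF // distrC ger0_norm; lra.
  (* A backward shift is a forward one when the progressions are read from [x - q * h]. *)
  rewrite -normrN -sumrN.
  rewrite (eq_bigr (fun u : 'I_M => G (x - q%:R * h + u%:R * h) -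
     G (x - q%:R * h + u%:R * h + q%:R * h))); first exact: progression_shift_le.
  by move=> u _; rewrite opprB; congr (G _ - G _); ring.
Qed.

(** The tent is a convolution of two intervals, so the sum over it is a double sum over
    progressions, each of which absorbs one difference; hence [rho ^+ 2]. The result is again of the
    form [bounded_lip], which allows induction on the coordinates. *)
Lemma sum_dif2_le G B L (M : nat) h s rho H : bounded_lip G B L ->
  0 <= rho <= 2 -> `|h| <= H ->
  2 <= rho \/ 2 * `|s| <= rho * (M%:R * `|h|) ->
  bounded_lip
    (fun x => \sum_(a : 'I_M * 'I_M) iter 2 (diff_by s) G (x + h * (a.1 + a.2)%:R))
    (M%:R ^+ 2 * (rho ^+ 2 * B + 4 * H * L)) (4 * M%:R ^+ 2 * L).
Proof.
move=> HG /andP[rho0 rho2] hH Hrho; have [B0 L0] := bounded_lip_ge0 HG.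
split; last first.
  have [_] := bounded_lip_sum (fun a : 'I_M * 'I_M => h * (a.1 + a.2)%:R)
    (bounded_lip_diff_by s (bounded_lip_diff_by s HG)).
  rewrite card_prod card_ord natrM => K x y; apply: le_trans (K x y) _.
  by rewrite le_eqVlt; apply/orP; left; apply/eqP; ring.
move=> x.
pose F1 y := \sum_(u < M) diff_by s G (y + u%:R * h).
have HF1 : bounded_lip F1 (M%:R * (rho * B + `|h| * L)) (M%:R * (2 * L)).
  split; first exact: sum_dif_le.
  by have [_] := bounded_lip_sum (fun a : 'I_M => a%:R * h) (bounded_lip_diff_by s HG); rewrite card_ord.
have := sum_dif_le HF1 rho0 Hrho x.
have -> : \sum_(u < M) diff_by s F1 (x + u%:R * h) =
  \sum_(a : 'I_M * 'I_M) iter 2 (diff_by s) G (x + h * (a.1 + a.2)%:R).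
  rewrite -(pair_bigA _ (fun u v : 'I_M => iter 2 (diff_by s) G (x + h * (u + v)%:R))) /=.
  apply: eq_bigr => u _; rewrite {1}/diff_by /F1 -sumrB; apply: eq_bigr => v _.
  rewrite /= {3}/diff_by; congr (diff_by s G _ - diff_by s G _); rewrite natrD; ring.
move/le_trans; apply.
have M0 : 0 <= M%:R :> R by [].
have -> : M%:R * (rho * (M%:R * (rho * B + `|h| * L)) + `|h| * (M%:R * (2 * L))) =
  M%:R ^+ 2 * (rho ^+ 2 * B + (rho + 2) * (`|h| * L)) by ring.
apply: ler_wpM2l; first exact: exprn_ge0.
rewrite lerD2l -mulrA; apply: ler_pM; rewrite ?mulr_ge0 //; first lra; first lra.
exact: ler_wpM2r.
Qed.

(** Induction on the coordinates: summing over the first one and dividing by [M ^ 2] improves the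
    bound by [rho ^+ 2] and multiplies the Lipschitz constant by 4. The additive term collects the
    rounding errors, with each later [rho i ^+ 2] estimated by 4. *)
Lemma sum_box_le (M : nat) s H m (h rho : 'I_m -> R) G B L :
  bounded_lip G B L -> 0 <= H ->
  (forall i, `|h i| <= H) -> (forall i, 0 <= rho i <= 2) ->
  (forall i, 2 <= rho i \/ 2 * `|s| <= rho i * (M%:R * `|h i|)) ->
  forall x,
  `|\sum_(f : {ffun 'I_m -> 'I_M * 'I_M})
     iter (m * 2) (diff_by s) G (x + \sum_i h i * ((f i).1 + (f i).2)%:R)| <=
  M%:R ^+ (m * 2) * (B * \prod_i (rho i) ^+ 2 + m%:R * 4 ^+ m * 4 * H * L).
Proof.
elim: m h rho G B L => [|m IH] h rho G B L HG H0 hH rho2 Hrho x.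
  rewrite big_ord0 mulr1 /= expr0 !mul0r addr0 mul1r.
  apply: (le_trans (ler_norm_sum _ _ _)).
  apply: (@le_trans _ _ (\sum_(f : {ffun 'I_0 -> 'I_M * 'I_M}) B)).
    by apply: ler_sum => f _; case: HG.
  by rewrite sumr_const card_ffun card_ord expn0.
have [B0 L0] := bounded_lip_ge0 HG.
rewrite sum_fcons.
pose G1 y := \sum_(a : 'I_M * 'I_M) iter 2 (diff_by s) G (y + h ord0 * (a.1 + a.2)%:R).
rewrite (eq_bigr (fun f : {ffun 'I_m -> 'I_M * 'I_M} => iter (m * 2) (diff_by s) G1
  (x + \sum_i h (lift ord0 i) * ((f i).1 + (f i).2)%:R))); last first.
  move=> f _; rewrite (iter_diff_by_sum (m * 2) s (iter 2 (diff_by s) G)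
    (fun a : 'I_M * 'I_M => h ord0 * (a.1 + a.2)%:R)).
  apply: eq_bigr => a _; rewrite -iterD mulSn addnC; congr (iter _ _ _ _).
  rewrite big_ord_recl fcons0 -addrA; congr (_ + _); rewrite addrC; congr (_ + _).
  by apply: eq_bigr => i _; rewrite fconsS.
have HG1 := sum_dif2_le HG (rho2 ord0) (hH ord0) (Hrho ord0).
apply: (le_trans (IH _ (fun i => rho (lift ord0 i)) _ _ _ HG1 H0 _ _ _ _)) => //.
rewrite big_ord_recl.
have P0 : 0 <= \prod_(i < m) rho (lift ord0 i) ^+ 2.
  by apply: prodr_ge0 => i _; exact: sqr_ge0.
have P1 : \prod_(i < m) rho (lift ord0 i) ^+ 2 <= 4 ^+ m.
  rewrite -[X in _ ^+ X]card_ord -prodr_const; apply: ler_prod => i _.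
  rewrite sqr_ge0 /=; have /andP[a b] := rho2 (lift ord0 i).
  have -> : 4 = 2 ^+ 2 :> R by ring.
  by rewrite ler_sqr ?nnegrE //.
set P := \prod_(_ < _) _ in P0 P1 *.
have E : M%:R ^+ (m.+1 * 2) = M%:R ^+ (m * 2) * M%:R ^+ 2 :> R.
  by rewrite -exprD mulSn addnC.
rewrite E -[leRHS]mulrA; apply: ler_wpM2l; first exact: exprn_ge0.
set r2 := rho ord0 ^+ 2; set M2 := M%:R ^+ 2.
have -> : M2 * (r2 * B + 4 * H * L) * P + m%:R * 4 ^+ m * 4 * H * (4 * M2 * L) =
   M2 * (B * (r2 * P) + (4 * H * L) * P + m%:R * 4 ^+ m.+1 * 4 * H * L).
  by rewrite exprS; ring.
apply: ler_wpM2l; first exact: exprn_ge0.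
rewrite -addrA lerD2l.
have -> : m.+1%:R * 4 ^+ m.+1 * 4 * H * L =
  4 * H * L * 4 ^+ m.+1 + m%:R * 4 ^+ m.+1 * 4 * H * L by ring.
rewrite lerD2r; apply: ler_wpM2l; first by rewrite !mulr_ge0.
by apply: (le_trans P1); rewrite exprS ler_peMl ?exprn_ge0 //; lra.
Qed.

(** The terms are compared with increments of [x / (1 + |x|)], whose derivative is [(1 + |x|)^-2].
    This function stays in [[-1, 1]], so the telescoped sum is bounded uniformly in the shift [tau],
    that is, in the direction of projection. *)
Lemma sum_inv_sq_le (tau : R) (n : nat) :
  \sum_(b < n) (Num.max 1 `|tau + b%:R|) ^- 2 <= 12.
Proof.
pose phi (x : R) := x / (1 + `|x|).
have phi_le x : `|phi x| <= 1.
  rewrite /phi normf_div [`|1 + _|]ger0_norm ?addr_ge0 //.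
  by rewrite ler_pdivrMr ?ltr_wpDr // mul1r lerDr.
have step x : (Num.max 1 `|x|) ^- 2 <= 6 * (phi (x + 1) - phi x).
  have inv1 : forall z : R, 1 <= z -> z^-1 <= 1 by move=> z z1; rewrite invf_le1 //; lra.
  have Hmax : 1 <= Num.max 1 `|x| by rewrite le_max lexx.
  have [x0|x0] := leP 0 x.
    rewrite /phi !ger0_norm ?addr_ge0 //.
    have -> : 6 * ((x + 1) / (1 + (x + 1)) - x / (1 + x)) = 6 / ((1 + (x + 1)) * (1 + x)).
      by field; rewrite !gt_eqF //; lra.
    have [x1|x1] := leP x 1.
      rewrite expr1n invr1 ler_pdivlMr; first nra.
      by rewrite mulr_gt0 //; lra.
    rewrite -[_ ^- 2]mul1r ler_pdivrMr; last by rewrite exprn_gt0 //; lra.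
    rewrite mulrAC ler_pdivlMr; last by rewrite mulr_gt0 //; lra.
    nra.
  have [x1|x1] := leP x (-1).
    rewrite /phi !ler0_norm; [|lra|lra].
    have -> : 6 * ((x + 1) / (1 - (x + 1)) - x / (1 - x)) = 6 / ((- x) * (1 - x)).
      by field; rewrite (lt_eqF x0) !gt_eqF //; lra.
    have -> : Num.max 1 (- x) = - x by apply: max_r; lra.
    rewrite -[_ ^- 2]mul1r ler_pdivrMr; last by rewrite exprn_gt0 //; lra.
    rewrite mulrAC ler_pdivlMr; last by rewrite mulr_gt0 //; lra.
    nra.
  rewrite /phi (ltr0_norm x0) (ger0_norm (_ : 0 <= x + 1)); last lra.
  have -> : 6 * ((x + 1) / (1 + (x + 1)) - x / (1 - x)) =
    6 * ((1 + x) * (1 - x) + (- x) * (2 + x)) / ((2 + x) * (1 - x)).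
    by field; rewrite !gt_eqF //; lra.
  apply: (@le_trans _ _ 1); first by apply: inv1; rewrite exprn_ege1 // le_max lexx.
  rewrite ler_pdivlMr; last by rewrite mulr_gt0 //; lra.
  nra.
apply: (@le_trans _ _ (\sum_(0 <= b < n) (6 * phi (tau + b.+1%:R) - 6 * phi (tau + b%:R)))).
  rewrite big_mkord; apply: ler_sum => b _; apply: (le_trans (step _)).
  by rewrite mulrBr (_ : tau + b.+1%:R = tau + b%:R + 1) //; ring.
rewrite telescope_sumr //.
have := phi_le (tau + n%:R); have := phi_le (tau + 0%:R).
by rewrite !ler_norml => /andP[? ?] /andP[? ?]; lra.
Qed.

End Differences.

(** * Plates and their slices *)

(** The convolution of the indicators of two intervals of length [M]. The offset [M] keeps the
    support away from 0, where the hyperplanes of all slopes meet. *)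
Definition tent (M k : nat) : nat :=
  (\sum_(a : 'I_M * 'I_M) (k == M + (a.1 + a.2)))%N.

Definition dotn (m n Y : nat) (b : {ffun 'I_m -> 'I_n}) (y : {ffun 'I_m -> 'I_Y}) : nat :=
  (\sum_i b i * y i)%N.

Section Plates.
Variable R : archiRealFieldType.
Variables m n M Y Z : nat.
Implicit Types (b : {ffun 'I_m -> 'I_n}) (x : {ffun 'I_m -> 'I_Y} * 'I_Z).

(** The indicator of [[t, t + M)] differenced [K] times with step [M]: consecutive layers of
    thickness [M] with alternating binomial weights. *)
Definition kappa (K z t : nat) : R :=
  \sum_(q < K.+1) (-1) ^+ q * 'C(K, q)%:R * \sum_(j < M) (z == t + q * M + j)%N%:R.

(* [x.1] are the horizontal coordinates, in units of [1 / M], and [x.2] is the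
   vertical one, in units of [1 / (n M)], so that the hyperplane of slope
   [b / n] is [x.2 = dotn b x.1]. *)
Definition plate b x : R := (\prod_i tent M (x.1 i))%N%:R * kappa (m * 2).+1 x.2 (dotn b x.1).

Lemma sum_natr_pick (T : finType) (F : T -> R) (p : pred T) (k : T) :
  (forall i, p i = (i == k)) -> \sum_i (p i)%:R * F i = F k.
Proof.
move=> pk; rewrite (bigD1 k) //= pk eqxx mul1r big1 ?addr0 // => i ik.
by rewrite pk (negbTE ik) mul0r.
Qed.

Lemma sum_tent (F : {ffun 'I_m -> nat} -> R) : (3 * M <= Y)%N ->
  \sum_(y : {ffun 'I_m -> 'I_Y}) (\prod_i tent M (y i))%N%:R * F [ffun i => y i : nat] =
  \sum_(f : {ffun 'I_m -> 'I_M * 'I_M}) F [ffun i => (M + ((f i).1 + (f i).2))%N].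
Proof.
move=> MY.
have lt3 (a : 'I_M * 'I_M) : (M + (a.1 + a.2) < Y)%N.
  by case: a => [[u uM] [v vM]] /=; lia.
under eq_bigr => y _.
  rewrite natr_prod; under eq_bigr do rewrite natr_sum.
  rewrite bigA_distr_bigA /= mulr_suml.
  over.
rewrite exchange_big /=; apply: eq_bigr => f _.
pose k : {ffun 'I_m -> 'I_Y} := [ffun i => Ordinal (lt3 (f i))].
rewrite -(_ : F [ffun i => k i : nat] = F _); last first.
  by congr F; apply/ffunP => i; rewrite !ffunE.
rewrite -(@sum_natr_pick _ (fun y : {ffun 'I_m -> 'I_Y} => F [ffun i => y i : nat])
  (fun y : {ffun 'I_m -> 'I_Y} => [forall i, y i == M + ((f i).1 + (f i).2) :> nat]%N)); last first.
  move=> y; apply/forallP/eqP => [H|-> i]; last by rewrite ffunE.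
  by apply/ffunP => i; apply/val_inj; rewrite ffunE /=; exact/eqP.
apply: eq_bigr => y _; congr (_ * _).
case: (boolP [forall _, _]) => [/forallP H|].
  by rewrite big1 // => i _; rewrite H.
by rewrite negb_forall => /existsP[i Hi]; rewrite (bigD1 i) //= (negbTE Hi) mul0r.
Qed.

Lemma sum_kappa K (t : nat) (c A : R) g : (t + K.+1 * M <= Z)%N ->
  \sum_(z < Z) kappa K z t * g (A + c * z%:R) =
  \sum_(j < M) iter K (diff_by (c * M%:R)) g (A + c * t%:R + c * j%:R).
Proof.
move=> tZ.
under eq_bigr => z _.
  rewrite /kappa mulr_suml; under eq_bigr => q _ do rewrite mulrAC mulr_sumr.
  over.
rewrite exchange_big /=.
under eq_bigr do rewrite exchange_big /=.
rewrite exchange_big /=; apply: eq_bigr => j _.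
rewrite iter_diff_by; apply: eq_bigr => q _.
have lt : (t + q * M + j < Z)%N.
  by case: q j => [q qK] [j jM] /=; nia.
under eq_bigr do rewrite mulrC.
rewrite (@sum_natr_pick _ (fun z : 'I_Z => (-1) ^+ q * 'C(K, q)%:R * g (A + c * z%:R))
  (fun z : 'I_Z => z == t + q * M + j :> nat)%N (Ordinal lt)) //=.
congr (_ * g _); rewrite !natrD natrM; ring.
Qed.

(** Along the hyperplane a unit step in coordinate [i] raises the height by [b i], so it moves the
    projection by [a i + c * b i]. These are the steps of the progressions in [sum_box_le]; they are
    all small only when the projection is nearly normal to the plate. *)
Lemma sum_plate b (a : 'I_m -> R) (c : R) g : (3 * M <= Y)%N ->
  (forall y : {ffun 'I_m -> 'I_Y}, dotn b y + (m * 2).+2 * M <= Z)%N ->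
  \sum_x plate b x * g ((\sum_i a i * (x.1 i)%:R) + c * x.2%:R) =
  \sum_(j < M) \sum_(f : {ffun 'I_m -> 'I_M * 'I_M})
    iter (m * 2).+1 (diff_by (c * M%:R)) g
      (c * j%:R + (\sum_i (a i + c * (b i)%:R) * M%:R) +
       \sum_i (a i + c * (b i)%:R) * ((f i).1 + (f i).2)%:R).
Proof.
move=> MY bZ.
rewrite -(pair_bigA _ (fun y z => plate b (y, z) *
  g ((\sum_i a i * (y i)%:R) + c * z%:R))) /=.
under eq_bigr => y _.
  rewrite /plate /=; under eq_bigr do rewrite -mulrA.
  rewrite -mulr_sumr sum_kappa // mulr_sumr.
  have -> : \sum_i a i * (y i)%:R + c * (dotn b y)%:R =
    \sum_i (a i + c * (b i)%:R) * ([ffun i => y i : nat] i)%:R.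
    rewrite /dotn natr_sum mulr_sumr -big_split /=; apply: eq_bigr => i _.
    by rewrite ffunE natrM mulrDl mulrA.
  over.
rewrite exchange_big /=; apply: eq_bigr => j _.
rewrite (sum_tent (fun v => iter (m * 2).+1 (diff_by (c * M%:R)) g
  (\sum_i (a i + c * (b i)%:R) * (v i)%:R + c * j%:R))) //.
apply: eq_bigr => f _; congr (iter _ _ _ _).
rewrite addrC -addrA; congr (_ + _); rewrite -big_split /=; apply: eq_bigr => i _.
by rewrite ffunE natrD mulrDr.
Qed.

Lemma slice_plate_le b (a : 'I_m -> R) (c H : R) (rho : 'I_m -> R) g : (3 * M <= Y)%N ->
  (forall y : {ffun 'I_m -> 'I_Y}, dotn b y + (m * 2).+2 * M <= Z)%N ->
  (forall u v, `|g u - g v| <= `|u - v|) ->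
  0 <= H -> (forall i, `|a i + c * (b i)%:R| <= H) -> (forall i, 0 <= rho i <= 2) ->
  (forall i, 2 <= rho i \/
     2 * `|c * M%:R| <= rho i * (M%:R * `|a i + c * (b i)%:R|)) ->
  `|\sum_x plate b x * g ((\sum_i a i * (x.1 i)%:R) + c * x.2%:R)| <=
  M%:R ^+ (m * 2).+1 * (`|c * M%:R| * \prod_i (rho i) ^+ 2 + m%:R * 4 ^+ m * 4 * H * 2).
Proof.
move=> MY bZ gL H0 hH rho2 Hrho; rewrite sum_plate //.
rewrite [M%:R ^+ _]exprS -mulrA -[X in X%:R * (_ * _)]card_ord; apply: norm_sum_le => j.
(* One difference is applied to [g], making it bounded by [|c * M|] and 2-Lipschitz; the other
   [m * 2] are left for the summation by parts. *)
rewrite (iterSr (m * 2) (diff_by (c * M%:R)) g).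
apply: (@sum_box_le R M (c * M%:R) H m _ rho) => //.
split=> [x|x y]; rewrite /diff_by.
  by apply: (le_trans (gL _ _)); rewrite opprD addrA subrr add0r normrN.
rewrite (_ : _ - _ = (g x - g y) - (g (x + c * M%:R) - g (y + c * M%:R))); last by ring.
apply: (le_trans (ler_normB _ _)).
have := gL x y; have := gL (x + c * M%:R) (y + c * M%:R).
have -> : x + c * M%:R - (y + c * M%:R) = x - y by ring.
lra.
Qed.

Lemma sum_slice_plate_le (th : 'I_m -> R) (th0 : R) g : (0 < n)%N ->
  (n ^ m.+1 <= M)%N -> (3 * M <= Y)%N ->
  (forall b (y : {ffun 'I_m -> 'I_Y}), dotn b y + (m * 2).+2 * M <= Z)%N ->
  (forall u v, `|g u - g v| <= `|u - v|) ->
  (forall i, `|th i| <= 1) -> `|th0| <= 1 ->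
  \sum_b `|\sum_x plate b x *
     g ((\sum_i th i / M%:R * (x.1 i)%:R) + th0 / (n%:R * M%:R) * x.2%:R)| <=
  M%:R ^+ (m * 2).+1 * ((48 ^+ m + m%:R * 4 ^+ m * 16) / n%:R).
Proof.
move=> n0 nM MY bZ gL thi th01.
have nR : 0 < n%:R :> R by rewrite ltr0n.
have M0 : (0 < M)%N by apply: leq_trans nM; rewrite expn_gt0 n0.
have MR : 0 < M%:R :> R by rewrite ltr0n.
have MR0 : M%:R != 0 :> R by rewrite gt_eqF.
have nR0 : n%:R != 0 :> R by rewrite gt_eqF.
set c := th0 / (n%:R * M%:R).
have cM : c * M%:R = th0 / n%:R by rewrite /c; field; rewrite nR0 MR0.
pose tau i := n%:R * th i / th0.
(* The ratio of twice the shift [|c * M|] to the length of the progression is [2 / |tau i + b i|],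
   capped at 2. If [th0 = 0] the shift vanishes and the gain 0 is admissible. *)
pose rho i (t : nat) : R := if th0 == 0 then 0 else 2 / Num.max 1 `|tau i + t%:R|.
have max1 (z : R) : 1 <= Num.max 1 z by rewrite le_max lexx.
have rho02 i t : 0 <= rho i t <= 2.
  rewrite /rho; case: ifP => _; first lra.
  have max0 := lt_le_trans ltr01 (max1 `|tau i + t%:R|).
  rewrite divr_ge0 ?(ltW max0) //=.
  by rewrite ler_pdivrMr // ler_peMr.
have hH b i : `|th i / M%:R + c * (b i)%:R| <= 2 / M%:R.
  apply: (le_trans (ler_normD _ _)).
  rewrite (_ : 2 / M%:R = 1 / M%:R + 1 / M%:R); last by field.
  apply: lerD.
    by rewrite normrM (ger0_norm (_ : 0 <= M%:R^-1)) ?invr_ge0 ?ler_wpM2r ?invr_ge0.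
  rewrite (_ : c * _ = th0 * ((b i)%:R / (n%:R * M%:R))); last by rewrite /c; ring.
  rewrite normrM -[leRHS]mul1r; apply: ler_pM => //.
  rewrite ger0_norm ?divr_ge0 ?mulr_ge0 // ler_pdivrMr ?mulr_gt0 //.
  by rewrite mul1r mulrCA mulVf // mulr1 ler_nat ltnW.
have H0 : 0 <= 2 / M%:R :> R by rewrite divr_ge0.
have key b := @slice_plate_le b (fun i => th i / M%:R) c (2 / M%:R)
  (fun i => rho i (b i)) g MY (bZ b) gL H0 (hH b) (fun i => rho02 i (b i)).
apply: (@le_trans _ _ (\sum_(b : {ffun 'I_m -> 'I_n}) M%:R ^+ (m * 2).+1 * (`|c * M%:R| * \prod_i (rho i (b i)) ^+ 2
   + m%:R * 4 ^+ m * 4 * (2 / M%:R) * 2))).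
  apply: ler_sum => b _; apply: key => i;
  rewrite /rho; have [th00|th00] := eqVneq th0 0.
    by right; rewrite cM th00 mul0r normr0 !mulr0 mul0r.
  have [H1|H1] := leP `|tau i + (b i)%:R| 1; first by left; rewrite invr1 mulr1.
  right.
  have -> : th i / M%:R + c * (b i)%:R = (th0 / (n%:R * M%:R)) * (tau i + (b i)%:R).
    by rewrite /tau /c; field; rewrite th00 nR0 MR0.
  rewrite cM !(normrM, normfV) (ger0_norm (ltW nR)) (ger0_norm (ltW MR)).
  rewrite le_eqVlt; apply/orP; left; apply/eqP; field.
  by rewrite MR0 nR0 /= gt_eqF // (lt_trans ltr01 H1).
rewrite -mulr_sumr ler_wpM2l ?exprn_ge0 // big_split /= -mulr_sumr cM.
rewrite sumr_const card_ffun !card_ord.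
have -> : (48 ^+ m + m%:R * 4 ^+ m * 16) / n%:R =
  48 ^+ m / n%:R + m%:R * 4 ^+ m * 16 / n%:R :> R by field.
apply: lerD.
  (* The gain is a product over coordinates, so its sum over all slopes is a product of
     one-dimensional sums, each at most [4 * 12 = 48]. *)
  rewrite -(bigA_distr_bigA (fun i (t : 'I_n) => rho i t ^+ 2)) /=.
  rewrite mulrC; apply: ler_pM; first 1 last.
  - by [].
  - rewrite -[X in _ ^+ X]card_ord -prodr_const; apply: ler_prod => i _.
    rewrite sumr_ge0 /=; last by move=> t _; exact: sqr_ge0.
    apply: (@le_trans _ _ (4 * \sum_(t < n) (Num.max 1 `|tau i + t%:R|) ^- 2)).
      rewrite mulr_sumr; apply: ler_sum => t _; rewrite /rho.
      case: ifP => _; first by rewrite expr0n mulr_ge0 // invr_ge0 exprn_ge0 // (le_trans ler01 (max1 _)).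
      by rewrite expr_div_n; apply: ler_wpM2r; [rewrite invr_ge0 exprn_ge0 // (le_trans ler01 (max1 _))|lra].
    by have := sum_inv_sq_le (tau i) n; lra.
  - rewrite normrM normfV (ger0_norm (ltW nR)) -[leRHS]mul1r.
    by rewrite ler_wpM2r // invr_ge0.
  by rewrite prodr_ge0 // => i _; rewrite sumr_ge0 // => t _; exact: sqr_ge0.
(* The rounding error of order [1 / M] occurs for [n ^ m] plates; [n ^ m.+1 <= M] makes the total of
   order [1 / n]. *)
rewrite -[_ *+ (n ^ m)]mulr_natr.
have -> : m%:R * 4 ^+ m * 4 * (2 / M%:R) * 2 * (n ^ m)%:R =
   m%:R * 4 ^+ m * 16 / n%:R * ((n ^ m.+1)%:R / M%:R) :> R.
  by rewrite expnS natrM; field; rewrite MR0 nR0.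
apply: ler_piMr; first by rewrite !mulr_ge0 ?invr_ge0 ?exprn_ge0.
by rewrite ler_pdivrMr // mul1r ler_nat.
Qed.

End Plates.

(** * Random signs *)

Section RandomSigns.
Variable R : realFieldType.

Lemma sign_avg_linear_sq (J : finType) (a : J -> R) :
  sign_avg (enum J) (fun e => (\sum_j e j * a j) ^+ 2) = \sum_j a j ^+ 2.
Proof.
have := @sign_avg_lin2 R J (enum J) a 0 (enum_uniq J).
rewrite expr0n add0r big_enum /= => <-; apply: sign_avg_ext => e.
by rewrite add0r /lin big_enum.
Qed.

Lemma sign_avg_linear_pow4_le (J : finType) (a : J -> R) :
  sign_avg (enum J) (fun e => (\sum_j e j * a j) ^+ 4) <= 3 * (\sum_j a j ^+ 2) ^+ 2.
Proof.
have := @sign_avg_lin4 R J (enum J) a 0 (enum_uniq J).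
rewrite !expr0n /= mulr0 mul0r !add0r big_enum /=; apply: le_trans.
rewrite le_eqVlt; apply/orP; left; apply/eqP; apply: sign_avg_ext => e.
by rewrite add0r /lin big_enum.
Qed.

Lemma norm_ge_sq_pow4 (x s : R) : 0 < s -> x ^+ 2 / s - x ^+ 4 / s ^+ 3 <= `|x|.
Proof.
move=> s0; rewrite -[x ^+ 2]real_normK ?num_real // -[4%N]/(2 * 2)%N exprM.
rewrite -[x ^+ 2]real_normK ?num_real //; have := normr_ge0 x; set u := `|x| => u0.
have -> : u ^+ 2 / s - (u ^+ 2) ^+ 2 / s ^+ 3 = u * ((u / s) - (u / s) ^+ 3).
  by field; rewrite gt_eqF.
rewrite -[leRHS]mulr1; apply: ler_wpM2l => //.
have : 0 <= u / s by rewrite divr_ge0 // ltW.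
set v := u / s => v0; have [v1|v1] := leP v 1.
  by have : 0 <= v ^+ 3 := exprn_ge0 3 v0; lra.
have : v <= v ^+ 3 by rewrite ler_eXnr // ltW.
lra.
Qed.

(* Khintchine's lower bound comes from [x^2 / s - x^4 / s^3 <= |x|] and the
   second and fourth moments. Being averages of one quadratic and quartic
   expression, both bounds hold for a common choice of signs. *)
Lemma random_signs (J A X : finType) (c : J -> A -> R) (p : J -> X -> R)
    (s0 u0 T0 E0 : R) :
  0 < s0 -> 0 < u0 -> 0 < T0 -> 0 < E0 ->
  (forall a, \sum_j c j a ^+ 2 <= s0 ^+ 2) ->
  (forall x, \sum_j p j x ^+ 2 <= u0 ^+ 2) ->
  T0 * (5 * s0) <= \sum_a \sum_j c j a ^+ 2 ->
  #|X|%:R * u0 <= E0 ->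
  exists2 e : J -> R, (forall j, `|e j| <= 1) &
    T0 / 2 + T0 / (2 * E0) * \sum_x `|\sum_j e j * p j x| <=
    \sum_a `|\sum_j e j * c j a|.
Proof.
move=> s00 u00 T00 E00 Hc Hp HT HE.
(* With [V] the variance, the second moment contributes [V / (3 * s0)] and the fourth costs at most
   [V / (9 * s0)]; the remaining factor [2 / 9] exceeds [1 / 5]. *)
pose s := 3 * s0; have sp : 0 < s by rewrite mulr_gt0.
(* By [v <= v ^+ 2 / (2 * u0) + u0 / 2] the penalty on [p] costs [T0 / 4] on average through the
   square and [T0 / 4] through the constant, which leaves [T0 / 2]. *)
pose lam := T0 / (2 * E0).
have lam0 : 0 <= lam by rewrite divr_ge0 ?mulr_ge0 // ltW.
pose G a e := s^-1 * (\sum_j e j * c j a) ^+ 2 + (- (s ^- 3)) * (\sum_j e j * c j a) ^+ 4.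
pose H x e := (2 * u0)^-1 * (\sum_j e j * p j x) ^+ 2.
have [e e1 He] := sign_avg_le_witness (enum J)
  (fun e => \sum_a G a e + (- lam) * \sum_x H x e).
exists e => //.
have avgG a : (\sum_j c j a ^+ 2) / (5 * s0) <= sign_avg (enum J) (G a).
  rewrite sign_avgD !sign_avgZ sign_avg_linear_sq.
  have V0 : 0 <= \sum_j c j a ^+ 2 by apply: sumr_ge0 => j _; exact: sqr_ge0.
  set V := \sum_j _ in V0 *; have VH := Hc a; rewrite -/V in VH.
  have H4 := sign_avg_linear_pow4_le (c^~ a); rewrite -/V in H4.
  apply: (@le_trans _ _ (s^-1 * V + - s ^- 3 * (3 * V ^+ 2))); last first.
    rewrite lerD2l ler_wnM2l // oppr_le0 invr_ge0 exprn_ge0 // ltW //.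
  rewrite /s.
  have -> : (3 * s0)^-1 * V + - (3 * s0) ^- 3 * (3 * V ^+ 2) =
     V / (5 * s0) + (V / s0) * (2 / 15 - V / s0 ^+ 2 / 9).
    by field; rewrite gt_eqF.
  rewrite lerDl mulr_ge0 ?divr_ge0 // ?(ltW s00) //.
  have : V / s0 ^+ 2 <= 1 by rewrite ler_pdivrMr ?exprn_gt0 // mul1r.
  lra.
have avgH x : sign_avg (enum J) (H x) <= u0 / 2.
  rewrite sign_avgZ sign_avg_linear_sq.
  have -> : u0 / 2 = (2 * u0)^-1 * u0 ^+ 2 by field; rewrite gt_eqF.
  by rewrite ler_wpM2l // invr_ge0 mulr_ge0 // ltW.
rewrite sign_avgD sign_avgZ !sign_avg_sum in He.
have A1 : T0 <= \sum_a sign_avg (enum J) (G a).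
  apply: (@le_trans _ _ (\sum_a (\sum_j c j a ^+ 2) / (5 * s0))); last first.
    by apply: ler_sum => a _; exact: avgG.
  by rewrite -mulr_suml ler_pdivlMr // mulr_gt0.
have A2 : \sum_x sign_avg (enum J) (H x) <= #|X|%:R * u0 / 2.
  apply: (le_trans (ler_sum _ (fun x _ => avgH x))).
  by rewrite sumr_const mulr_natl mulrnAl.
have A3 : lam * \sum_x `|\sum_j e j * p j x| <= lam * \sum_x H x e + lam * (#|X|%:R * u0 / 2).
  rewrite -mulrDr ler_wpM2l //.
  rewrite -mulrA mulr_natl -sumr_const -big_split /=; apply: ler_sum => x _.
  rewrite /H -[_ ^+ 2]real_normK ?num_real //; set v := `|_|.
  have -> : (2 * u0)^-1 * v ^+ 2 + u0 / 2 = v + (v - u0) ^+ 2 / (2 * u0).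
    by field; rewrite gt_eqF.
  by rewrite lerDl divr_ge0 ?sqr_ge0 // mulr_ge0 // ltW.
have A4 : \sum_a G a e <= \sum_a `|\sum_j e j * c j a|.
  apply: ler_sum => a _; rewrite /G mulrC mulNr -[s ^- 3 * _]mulrC.
  exact: norm_ge_sq_pow4.
have A5 : lam * \sum_x sign_avg (enum J) (H x) <= lam * (#|X|%:R * u0 / 2).
  by rewrite ler_wpM2l.
have A6 : lam * (#|X|%:R * u0) <= T0 / 2.
  apply: (@le_trans _ _ (lam * E0)); first by rewrite ler_wpM2l.
  by rewrite /lam le_eqVlt; apply/orP; left; apply/eqP; field; rewrite gt_eqF.
rewrite -/lam; lra.
Qed.

End RandomSigns.


(** * Counting slopes and lattice points *)

Section Counting.
Local Open Scope nat_scope.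

Lemma sum_window (n a l : nat) :
  \sum_(i < n) (a <= i < a + l) = minn n (a + l) - minn n a.
Proof.
elim: n => [|n IH]; first by rewrite big_ord0 !min0n.
by rewrite big_ord_recr /= IH; case: (leqP a n) => h1; case: (ltnP n (a + l)) => h2 /=; lia.
Qed.

Lemma sum_progression_window_le (n c e lo M w : nat) : 0 < M -> M <= c ->
  \sum_(i < n) (lo <= i * c + e < lo + w * M) <= w.
Proof.
move=> M0 Mc.
pose P := fun i => (lo <= i * c + e).
have exP : exists i, P i by exists lo; rewrite /P; nia.
pose i0 := ex_minn exP.
apply: (@leq_trans (\sum_(i < n) (i0 <= i < i0 + w))); last by rewrite sum_window; lia.
apply: leq_sum => i _; case: (boolP (lo <= _ < _)) => // /andP[h1 h2].
rewrite /i0; case: ex_minnP => j Pj minj.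
have ji : j <= i by exact: minj.
rewrite ji /= lt0b; rewrite /P in Pj.
have h3 : (i - j) * M <= (i - j) * c by rewrite leq_mul2l Mc orbT.
have h4 : (i - j) * c = i * c - j * c by rewrite mulnBl.
have h5 : j * c <= i * c by rewrite leq_mul2r ji orbT.
rewrite ltnNge; apply/negP => h6.
have h7 : w * M <= (i - j) * M by rewrite leq_mul2r; apply/orP; right; lia.
lia.
Qed.

(** Once the other slopes are fixed, [dotn b y] runs through an arithmetic progression in [b ord0]
    with step [y ord0 >= M], so at most [w] of its terms fall in the window. This is the count of
    plates through a point. *)
Lemma sum_slopes_window_le (k n Y lo M w : nat) (y : {ffun 'I_k.+1 -> 'I_Y}) :
  0 < M -> M <= y ord0 ->
  \sum_(b : {ffun 'I_k.+1 -> 'I_n}) (lo <= dotn b y < lo + w * M) <= w * n ^ k.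
Proof.
move=> M0 My; rewrite sum_fcons.
apply: (@leq_trans (\sum_(b : {ffun 'I_k -> 'I_n}) w)); last first.
  by rewrite sum_nat_const card_ffun !card_ord mulnC.
apply: leq_sum => b _.
pose e := \sum_(i < k) b i * y (lift ord0 i).
apply: leq_trans (@sum_progression_window_le n (y ord0) e lo M w M0 My).
apply: leq_sum => i _; rewrite /dotn big_ord_recl fcons0.
by under eq_bigr do rewrite fconsS.
Qed.

Lemma sum_box_indicator (m Y Z : nat) (lo : 'I_m -> nat) (l loz lz : nat) :
  \sum_(x : {ffun 'I_m -> 'I_Y} * 'I_Z)
    ([forall i, lo i <= x.1 i < lo i + l] && (loz <= x.2 < loz + lz)) =
  (\prod_i (minn Y (lo i + l) - minn Y (lo i))) * (minn Z (loz + lz) - minn Z loz).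
Proof.
under [in RHS]eq_bigr do rewrite -sum_window.
rewrite -sum_window bigA_distr_bigA /= big_distrl /=.
rewrite -(pair_bigA _ (fun (y : {ffun 'I_m -> 'I_Y}) (z : 'I_Z) =>
  ([forall i, lo i <= y i < lo i + l] && (loz <= z < loz + lz)) : nat)) /=.
apply: eq_bigr => y _; rewrite big_distrr /=; apply: eq_bigr => z _.
rewrite -mulnb; congr (_ * _).
case: (boolP [forall _, _]) => [/forallP H|].
  by rewrite big1 // => i _; rewrite H.
by rewrite negb_forall => /existsP[i Hi]; rewrite (bigD1 i) //= (negbTE Hi) mul0n.
Qed.

Lemma tent_supp (M k : nat) : tent M k != 0 -> M <= k.
Proof.
apply: contraNT; rewrite -ltnNge => kM; rewrite /tent big1 // => a _.
by apply/eqP; rewrite eqb0; apply/eqP; lia.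
Qed.

Lemma tentE (M k : nat) :
  tent M k = \sum_(u < M) ((M + u <= k) && (k < M + u + M)).
Proof.
rewrite /tent -(pair_bigA _ (fun u v : 'I_M => (k == M + (u + v)) : nat)) /=.
apply: eq_bigr => u _.
rewrite -[RHS](_ : \sum_(v < M) (k - M - u <= v < k - M - u + 1) * (M + u <= k) = _).
  by apply: eq_bigr => v _; rewrite mulnb; congr nat_of_bool; lia.
by rewrite -big_distrl /= sum_window; lia.
Qed.

Lemma tent_le (M k : nat) : tent M k <= M.
Proof.
rewrite tentE; apply: (@leq_trans (\sum_(u < M) 1)); last by rewrite sum_nat_const card_ord muln1.
by apply: leq_sum => u _; case: (_ && _).
Qed.

(** The middle three quarters of the support, which contain the bumps. *)
Lemma tent_ge (M k : nat) : 5 * M <= 4 * k -> 4 * k.+1 <= 11 * M -> M <= 4 * tent M k.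
Proof.
move=> h1 h2; rewrite tentE.
have -> : \sum_(u < M) ((M + u <= k) && (k < M + u + M)) =
  \sum_(u < M) (k.+1 - 2 * M <= u < k.+1 - 2 * M + (k.+1 - M - (k.+1 - 2 * M))).
  by apply: eq_bigr => u _; congr nat_of_bool; lia.
by rewrite sum_window; lia.
Qed.

End Counting.

(** * The profile across a plate *)

Section Kappa.
Variable R : archiRealFieldType.

Lemma sum_eqn_le1 (M k : nat) (t : nat) : \sum_(j < M) (k == t + j)%N%:R <= 1 :> R.
Proof.
rewrite -natr_sum lern1; apply: (@leq_trans (\sum_(j < M) (k - t <= j < k - t + 1))%N).
  by apply: leq_sum => j _; case: eqP => // ->; rewrite addnC addnK leqnn addn1 ltnSn.
by rewrite sum_window; lia.
Qed.

Lemma kappa_norm_le (M K z t : nat) : `|kappa R M K z t| <= 2 ^+ K.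
Proof.
apply: (le_trans (ler_norm_sum _ _ _)).
apply: (@le_trans _ _ (\sum_(q < K.+1) 'C(K, q)%:R)).
  apply: ler_sum => q _; rewrite !normrM normrX normrN1 expr1n mul1r normr_nat.
  rewrite ler_piMr // ger0_norm ?sum_eqn_le1 //.
  by apply: sumr_ge0 => j _.
rewrite -natr_sum -natrX ler_nat -[2%N]/(1 + 1)%N expnDn.
by apply: leq_sum => q _; rewrite !exp1n !muln1.
Qed.

Lemma kappa_supp (M K z t : nat) : kappa R M K z t != 0 -> (t <= z < t + K.+1 * M)%N.
Proof.
apply: contraR => H; rewrite /kappa big1 // => q _; rewrite big1 ?mulr0 // => j _.
case: eqP => // zE; case/negP: H; rewrite zE -addnA leq_addr ltn_add2l /=.
by case: q j zE => q qK [j jM] _ /=; nia.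
Qed.

Lemma kappa_first (M K z t : nat) : (t <= z < t + M)%N -> kappa R M K z t = 1.
Proof.
move=> /andP[h1 h2]; rewrite /kappa big_ord_recl /= expr0 bin0 !mul1r [X in _ + X]big1 ?addr0.
  have lt : (z - t < M)%N by lia.
  rewrite mul0n addn0 (bigD1 (Ordinal lt)) //= subnKC // eqxx big1 ?addr0 // => j.
  by rewrite -val_eqE /= => jz; case: eqP => // zE; case/eqP: jz; lia.
move=> q _; rewrite big1 ?mulr0 // => j _; case: eqP => // zE.
by move: h2; rewrite zE /bump /= => h2; nia.
Qed.

End Kappa.

(** * Pairing of plates with bumps *)

Lemma dotn_le m n Y (b : {ffun 'I_m -> 'I_n}) (x y : {ffun 'I_m -> 'I_Y}) (l : nat) :
  (forall i, x i <= y i + l)%N -> (dotn b x <= dotn b y + m * (n * l))%N.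
Proof.
move=> xy; rewrite -[X in (_ + X * _)%N]card_ord -sum_nat_const -big_split /=.
apply: leq_sum => i _; apply: (@leq_trans (b i * (y i + l))%N); first by rewrite leq_mul2l xy orbT.
by rewrite mulnDr leq_add2l leq_mul2r ltnW ?orbT.
Qed.

Lemma dotn_bound m n Y (b : {ffun 'I_m -> 'I_n}) (y : {ffun 'I_m -> 'I_Y}) :
  (dotn b y <= m * (n * Y))%N.
Proof.
rewrite -[X in (X * _)%N]card_ord -sum_nat_const; apply: leq_sum => i _.
by apply: leq_mul; exact: ltnW.
Qed.

(* [2 * lp] is the radius of the bumps [psi], in horizontal lattice steps. The
   plates have the larger thickness [M], so that a bump centered in the middle
   of the first layer of a plate meets no other layer of it. *)
Section Bumps.
Variables (R : archiRealFieldType) (k n lp : nat).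
Hypotheses (n_gt0 : (0 < n)%N) (lp_gt0 : (0 < lp)%N).

Definition thickness := (8 * (k + 2) * n * lp)%N.
Definition width := (3 * thickness)%N.
(** The hyperplanes reach at most [k.+1 * (n * width)], and the [K.+1] layers above them take the
    remaining [(k.+1 * 2 + 2) * thickness]. *)
Definition height := ((3 * k.+1 * n + k.+1 * 2 + 2) * thickness)%N.

Local Notation M := thickness.
Local Notation Y := width.
Local Notation Z := height.
Local Notation K := (k.+1 * 2).+1.

Lemma thickness_gt0 : (0 < M)%N.
Proof. by rewrite /thickness !muln_gt0 n_gt0 lp_gt0 addn2. Qed.

Lemma center_proof (j : 'I_(2 * (k + 2) * n)) :
  (12 * (k + 2) * n * lp + 4 * lp * j < Y)%N.
Proof. by case: j => j /= jlt; rewrite /width /thickness; nia. Qed.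

(** The centers fill [[3/2 M, 5/2 M)], where the tents are large, with spacing [4 * lp], twice the
    radius of a bump, so that the bumps are disjoint. *)
Definition center (a : {ffun 'I_k.+1 -> 'I_(2 * (k + 2) * n)}) : {ffun 'I_k.+1 -> 'I_Y} :=
  [ffun i => Ordinal (center_proof (a i))].

Definition centerz (j : nat) : nat := (4 * n * lp * j)%N.

Lemma dotn_height (b : {ffun 'I_k.+1 -> 'I_n}) (y : {ffun 'I_k.+1 -> 'I_Y}) :
  (dotn b y + (k.+1 * 2).+2 * M <= Z)%N.
Proof.
by have := dotn_bound b y; rewrite /height /width; nia.
Qed.

Local Notation X := ({ffun 'I_k.+1 -> 'I_Y} * 'I_Z)%type.
Local Notation A := ({ffun 'I_k.+1 -> 'I_(2 * (k + 2) * n)} * 'I_Z)%type.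
Local Notation J := {ffun 'I_k.+1 -> 'I_n}.

Lemma center_val a i : center a i = (12 * (k + 2) * n * lp + 4 * lp * a i)%N :> nat.
Proof. by rewrite ffunE. Qed.

Lemma plate_norm_le (b : J) (x : X) : `|plate R M b x| <= 2 ^+ K * M%:R ^+ k.+1.
Proof.
rewrite normrM mulrC; apply: ler_pM => //; first exact: kappa_norm_le.
rewrite normr_nat -natrX ler_nat -[X in (_ ^ X)%N]card_ord -prod_nat_const.
by apply: leq_prod => i _; exact: tent_le.
Qed.

Lemma plate_supp (b : J) (x : X) : plate R M b x != 0 ->
  (M <= x.1 ord0)%N /\ (dotn b x.1 <= x.2 < dotn b x.1 + K.+1 * M)%N.
Proof.
rewrite mulf_eq0 negb_or => /andP[h1 /kappa_supp h2]; split=> //.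
apply: tent_supp; apply: contra h1 => /eqP t0.
by rewrite (bigD1 ord0) //= t0 mul0n.
Qed.

(** For a plate through [x], [dotn b x.1] lies in a window of length [K.+1 * M] ending at [x.2]. The
    factor [K + 3] is the one of [sum_coef_sq_le], where the extent of a bump widens the window by
    [M] on either side. *)
Lemma sum_plate_sq_le (x : X) :
  \sum_(b : J) plate R M b x ^+ 2 <= (K + 3)%N%:R * n%:R ^+ k * (2 ^+ K * M%:R ^+ k.+1) ^+ 2.
Proof.
have c0 : 0 <= 2 ^+ K * M%:R ^+ k.+1 :> R by rewrite mulr_ge0 ?exprn_ge0.
apply: (@le_trans _ _ (\sum_(b : J)
  ((M <= x.1 ord0)%N && (x.2.+1 - K.+1 * M <= dotn b x.1 < (x.2.+1 - K.+1 * M) + (K + 3) * M)%N)%:R *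
  (2 ^+ K * M%:R ^+ k.+1) ^+ 2)).
  apply: ler_sum => b _; have [p0|p0] := eqVneq (plate R M b x) 0.
    by rewrite p0 expr0n mulr_ge0 // sqr_ge0.
  have [h1 h2] := plate_supp p0; rewrite h1 /=.
  rewrite (_ : (_ <= _ < _)%N = true); last by have := thickness_gt0; nia.
  by rewrite mul1r -[leLHS]real_normK ?num_real // ler_sqr ?nnegrE // plate_norm_le.
rewrite -mulr_suml ler_wpM2r ?sqr_ge0 // -natr_sum -natrX -natrM ler_nat.
have [h1|h1] := leqP M (x.1 ord0); first exact: sum_slopes_window_le thickness_gt0 h1.
by rewrite big1.
Qed.

(** The counting depends only on the size, the support and the core of the bumps; the functions
    [spike] are shown to qualify in [plate_measures]. *)
Variables (psi : A -> X -> R) (r : R).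
Hypothesis r_gt0 : 0 < r.
Hypothesis psi_bound : forall (a : A) (x : X), 0 <= psi a x <= r.
Hypothesis psi_supp : forall (a : A) (x : X), psi a x != 0 ->
  (forall i, x.1 i < center a.1 i + 2 * lp /\ center a.1 i < x.1 i + 2 * lp)%N /\
  (x.2 < centerz a.2 + 2 * n * lp /\ centerz a.2 < x.2 + 2 * n * lp)%N.
Hypothesis psi_core : forall (a : A) (x : X),
  (forall i, center a.1 i <= x.1 i < center a.1 i + lp)%N ->
  (centerz a.2 <= x.2 < centerz a.2 + n * lp)%N -> r / 2 <= psi a x.

Definition coef (b : J) (a : A) : R := \sum_x plate R M b x * psi a x.

Definition coef_max : R :=
  r * (2 ^+ K * M%:R ^+ k.+1) * ((4 * lp) ^ k.+1 * (4 * n * lp))%N%:R.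

Lemma coef_norm_le (b : J) (a : A) : `|coef b a| <= coef_max.
Proof.
have c0 : 0 <= r * (2 ^+ K * M%:R ^+ k.+1) :> R.
  by apply: mulr_ge0; [exact: ltW|apply: mulr_ge0; exact: exprn_ge0].
apply: (le_trans (ler_norm_sum _ _ _)).
pose lo i := (center a.1 i - 2 * lp)%N; pose loz := (centerz a.2 - 2 * n * lp)%N.
apply: (@le_trans _ _ (\sum_(x : X) r * (2 ^+ K * M%:R ^+ k.+1) *
  ([forall i, lo i <= x.1 i < lo i + 4 * lp] && (loz <= x.2 < loz + 4 * n * lp))%N%:R)).
  apply: ler_sum => x _; have [p0|p0] := eqVneq (psi a x) 0.
    by rewrite p0 mulr0 normr0 mulr_ge0.
  have [h1 h2] := psi_supp p0.
  rewrite (_ : _ && _ = true); last first.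
    rewrite /loz; apply/andP; split; last by lia.
    by apply/forallP => i; rewrite /lo; have [] := h1 i; rewrite center_val; nia.
  have /andP[ps0 ps1] := psi_bound a x.
  by rewrite mulr1 normrM mulrC ger0_norm //; apply: ler_pM => //; exact: plate_norm_le.
rewrite -mulr_sumr ler_wpM2l // -natr_sum ler_nat sum_box_indicator.
apply: leq_mul; last by lia.
rewrite -[X in (_ ^ X)%N]card_ord -prod_nat_const; apply: leq_prod => i _; lia.
Qed.

Lemma coef_supp (b : J) (a : A) : coef b a != 0 ->
  (dotn b (center a.1) <= centerz a.2 + M)%N /\
  (centerz a.2 < dotn b (center a.1) + (K + 2) * M)%N.
Proof.
move=> c0; have [x px] : exists x, plate R M b x * psi a x != 0.
  apply/existsP; apply: contraR c0; rewrite negb_exists => /forallP H.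
  by rewrite /coef big1 // => x _; have := H x; rewrite negbK => /eqP.
move: px; rewrite mulf_eq0 negb_or => /andP[/plate_supp[_ h1] /psi_supp[h2 h3]].
have d1 := @dotn_le _ _ _ b x.1 (center a.1) (2 * lp) (fun i => ltnW (h2 i).1).
have d2 := @dotn_le _ _ _ b (center a.1) x.1 (2 * lp) (fun i => ltnW (h2 i).2).
have ME : (M = 4 * (k.+1 * (n * (2 * lp))) + 8 * n * lp)%N by rewrite /thickness; lia.
by lia.
Qed.

Lemma sum_coef_sq_le (a : A) :
  \sum_(b : J) coef b a ^+ 2 <= (K + 3)%N%:R * n%:R ^+ k * coef_max ^+ 2.
Proof.
have c0 : 0 <= coef_max.
  by apply: mulr_ge0 => //; apply: mulr_ge0; [exact: ltW|apply: mulr_ge0; exact: exprn_ge0].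
pose lo := ((centerz a.2).+1 - (K + 2) * M)%N.
apply: (@le_trans _ _ (\sum_(b : J)
  (lo <= dotn b (center a.1) < lo + (K + 3) * M)%N%:R * coef_max ^+ 2)).
  apply: ler_sum => b _; have [p0|p0] := eqVneq (coef b a) 0.
    by rewrite p0 expr0n mulr_ge0 // sqr_ge0.
  have [h1 h2] := coef_supp p0.
  rewrite (_ : (_ <= _ < _)%N = true); last by rewrite /lo; have := thickness_gt0; nia.
  by rewrite mul1r -[leLHS]real_normK ?num_real // ler_sqr ?nnegrE // coef_norm_le.
rewrite -mulr_suml ler_wpM2r ?sqr_ge0 // -natr_sum -natrX -natrM ler_nat.
apply: sum_slopes_window_le thickness_gt0 _.
by rewrite center_val /thickness; nia.
Qed.

Definition coef_min : R :=
  r / 2 * (M%:R / 4) ^+ k.+1 * (lp ^ k.+1 * (n * lp))%N%:R.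

(** Some bump over [a1] lies inside the first layer of the plate, where [kappa] is 1. Nothing
    cancels there, and the core of the bump alone gives [coef_min], with tents at least [M / 4] and
    [psi] at least [r / 2]. *)
Lemma coef_lower (b : J) (a1 : {ffun 'I_k.+1 -> 'I_(2 * (k + 2) * n)}) :
  exists a2 : 'I_Z, coef_min <= coef b (a1, a2).
Proof.
pose d := dotn b (center a1).
have nlp0 : (0 < n * lp)%N by rewrite muln_gt0 n_gt0.
(* The height is rounded up to the grid of step [4 n lp], from [2 (k + 2) n lp] above the
   hyperplane. Within the bump [dotn b] changes by at most [2 (k + 1) n lp] and the height by
   [2 n lp], so the bump stays between 0 and [(4 k + 12) n lp < M] above the hyperplane. *)
pose j := ((d + 2 * (k + 2) * (n * lp)) %/ (4 * (n * lp))).+1.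
have j1 : (centerz j <= d + 2 * (k + 2) * (n * lp) + 4 * (n * lp))%N.
  have := leq_divM (d + 2 * (k + 2) * (n * lp)) (4 * (n * lp)).
  by rewrite /centerz /j; nia.
have j2 : (d + 2 * (k + 2) * (n * lp) <= centerz j)%N.
  have := ltn_ceil (d + 2 * (k + 2) * (n * lp)) (_ : (0 < 4 * (n * lp)))%N.
  by rewrite muln_gt0 nlp0 /centerz /j => /(_ isT); nia.
have ME : (M = 8 * (k + 2) * (n * lp))%N by rewrite /thickness; lia.
have dZ : (d + (k.+1 * 2).+2 * M <= Z)%N by exact: dotn_height.
have jcz : (j <= centerz j)%N by rewrite /centerz leq_pmull // !muln_gt0 n_gt0 lp_gt0.
have jZ : (j < Z)%N by nia.
exists (Ordinal jZ); rewrite /coef.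
pose ind (x : X) := ([forall i, center a1 i <= x.1 i < center a1 i + lp] &&
                (centerz j <= x.2 < centerz j + n * lp))%N.
have core : \sum_(x : X) (ind x)%:R = (lp ^ k.+1 * (n * lp))%N%:R :> R.
  rewrite -natr_sum /ind sum_box_indicator; congr (_%:R)%R; congr (_ * _)%N; last by nia.
  rewrite -[X in (_ ^ X)%N]card_ord -prod_nat_const; apply: eq_bigr => i _.
  by have := ltn_ord (a1 i); rewrite !center_val /width ME; nia.
rewrite /coef_min -core mulr_sumr; apply: ler_sum => x _.
have [p0|p0] := eqVneq (psi (a1, Ordinal jZ) x) 0.
  rewrite p0 mulr0; case: (boolP (ind x)) => [/andP[/forallP h1 h2]|_]; last by rewrite mulr0.
  by have := @psi_core (a1, Ordinal jZ) x h1 h2; rewrite p0; have := r_gt0; lra.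
have [/= h1 h2] := psi_supp p0.
have d1 := @dotn_le _ _ _ b x.1 (center a1) (2 * lp) (fun i => ltnW (h1 i).1).
have d2 := @dotn_le _ _ _ b (center a1) x.1 (2 * lp) (fun i => ltnW (h1 i).2).
rewrite -/d in d1 d2.
rewrite /plate kappa_first ?mulr1; last first.
  have e1 : (k.+1 * (n * (2 * lp)) = 2 * k.+1 * (n * lp))%N by lia.
  rewrite e1 in d1 d2; rewrite -!mulnA in h2.
  by move: (centerz _) (dotn b x.1) (x.2 : nat) h2 d1 d2 j1 j2 ME => cz dx z; clear; lia.
case: (boolP (ind x)) => [/andP[/forallP g1 g2]|_]; last first.
  by rewrite mulr0 mulr_ge0 //; case/andP: (psi_bound (a1, Ordinal jZ) x).
rewrite mulr1 mulrC; apply: ler_pM.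
- by rewrite exprn_ge0 // divr_ge0.
- by rewrite divr_ge0 // ltW.
- rewrite expr_div_n ler_pdivrMr ?exprn_gt0 // -!natrX -natrM ler_nat.
  have prodc c : (\prod_(i < k.+1) c = c ^ k.+1)%N by rewrite prod_nat_const card_ord.
  rewrite -!prodc mulnC -big_split /=.
  apply: leq_prod => i _; apply: tent_ge.
    by have := g1 i; rewrite center_val ME; nia.
  by have := g1 i; have := ltn_ord (a1 i); rewrite center_val ME; nia.
- exact: psi_core.
Qed.

End Bumps.

(** * Choice of the signs *)

Section Signs.
Variables (R : archiRealFieldType) (k : nat).
Local Notation K := (k.+1 * 2).+1.

(** In units of [n * N0 * M ^ K], where [N0] is the square root of [n ^ k], [mass_const] is the
    bound [E0] and [gain_const * r] the bound [T0] to which [random_signs] is applied. *)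
Definition mass_const : R :=
  3 ^+ k.+1 * (5 * k.+1 + 2)%N%:R * (K + 3)%N%:R * 2 ^+ K.

Definition gain_const : R :=
  2 ^+ k.+1 * (k + 2)%N%:R ^+ k.+1 * (8 * 4 ^+ k.+1 ^+ 2 * 2 ^+ K) ^- 2 *
  2 ^+ K * 4 ^+ k.+1 * 4 / (5 * (K + 3)%N%:R * (8 ^+ k.+1 * 8 * (k + 2)%N%:R ^+ k.+1 * (k + 2)%N%:R)).

Lemma mass_const_gt0 : 0 < mass_const.
Proof.
rewrite /mass_const; move: (exprn_gt0 k.+1 (ltr0Sn R 2)) (exprn_gt0 K (ltr0Sn R 1)).
move: (_ ^+ _) (_ ^+ _) => a b a0 b0.
by rewrite !mulr_gt0 // ltr0n ?addn2 ?addn3.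
Qed.

Lemma gain_const_gt0 : 0 < gain_const.
Proof.
have q0 : 0 < (k + 2)%N%:R :> R by rewrite ltr0n addn2.
have w0 : 0 < (K + 3)%N%:R :> R by rewrite ltr0n addn3.
rewrite /gain_const; move: (exprn_gt0 k.+1 q0) (exprn_gt0 k.+1 (ltr0Sn R 7))
  (exprn_gt0 k.+1 (ltr0Sn R 3)) (exprn_gt0 k.+1 (ltr0Sn R 1)) (exprn_gt0 K (ltr0Sn R 1)).
move: (_ ^+ _) (8 ^+ _) (4 ^+ _) (2 ^+ k.+1) (2 ^+ K) => qm e8 e4 e2 eK *.
by rewrite !(mulr_gt0, divr_gt0, invr_gt0) // exprn_gt0 // !mulr_gt0 // exprn_gt0.
Qed.

Local Notation lattice n lp := ({ffun 'I_k.+1 -> 'I_(width k n lp)} * 'I_(height k n lp))%type.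
Local Notation centers n lp := ({ffun 'I_k.+1 -> 'I_(2 * (k + 2) * n)} * 'I_(height k n lp))%type.

(** An equality, because [gain_const] is defined as the exact quotient. Powers with variable
    exponents are replaced by variables to leave a plain field identity. *)
Lemma gain_identity (n N0 q lp qm Lm e8 e4 e2 eK w r : R) :
  0 < n -> 0 < N0 -> 0 < q -> 0 < qm -> 0 < e8 -> 0 < e4 -> 0 < eK -> 0 < w ->
  forall M Mm, M = 8 * q * n * lp -> Mm = e8 * qm * (n * N0 ^+ 2) * Lm ->
  e2 * qm * (8 * e4 ^+ 2 * eK) ^- 2 * eK * e4 * 4 / (5 * w * (e8 * 8 * qm * q)) *
    r * (n * N0 * (Mm ^+ 2 * M)) *
    (5 * (w * N0 * (r * (eK * Mm) * (e4 * Lm * (4 * n * lp))))) =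
  (r / 2 * (Mm / e4) * (Lm * (n * lp))) ^+ 2 * (n * N0 ^+ 2) *
    (e2 * qm * (n * N0 ^+ 2)).
Proof.
move=> n0 N00 q0 qm0 e80 e40 eK0 w0 M Mm -> ->; field.
by rewrite !gt_eqF.
Qed.

Lemma plate_signs (n lp : nat) (n0 : (0 < n)%N) (lp0 : (0 < lp)%N) (N0 r : R)
  (psi : centers n lp -> lattice n lp -> R) :
  0 < N0 -> N0 ^+ 2 = n%:R ^+ k -> 0 < r ->
  (forall a x, 0 <= psi a x <= r) ->
  (forall (a : centers n lp) (x : lattice n lp), psi a x != 0 ->
    (forall i, x.1 i < center n0 lp0 a.1 i + 2 * lp /\ center n0 lp0 a.1 i < x.1 i + 2 * lp)%N /\
    (x.2 < centerz n lp a.2 + 2 * n * lp /\ centerz n lp a.2 < x.2 + 2 * n * lp)%N) ->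
  (forall (a : centers n lp) (x : lattice n lp), (forall i, center n0 lp0 a.1 i <= x.1 i < center n0 lp0 a.1 i + lp)%N ->
    (centerz n lp a.2 <= x.2 < centerz n lp a.2 + n * lp)%N -> r / 2 <= psi a x) ->
  let M := thickness k n lp in
  exists2 e : {ffun 'I_k.+1 -> 'I_n} -> R, (forall b, `|e b| <= 1) &
    gain_const * r * (n%:R * N0 * M%:R ^+ K) / 2 +
    gain_const * r / (2 * mass_const) * \sum_(x : lattice n lp) `|\sum_b e b * plate R M b x| <=
    \sum_a `|\sum_b e b * coef psi b a|.
Proof.
move=> N00 N02 r0 psi_bound psi_supp psi_core M.
have M0 : (0 < M)%N by exact: thickness_gt0.
have MR : 0 < M%:R :> R by rewrite ltr0n.
have nR : 0 < n%:R :> R by rewrite ltr0n.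
have lR : 0 < lp%:R :> R by rewrite ltr0n.
have w0 : 0 < (K + 3)%N%:R :> R by rewrite ltr0n.
have w1 : 1 <= (K + 3)%N%:R :> R by rewrite ler1n.
have eK : 0 < 2 ^+ K :> R by exact: exprn_gt0.
have Mm0 : 0 < M%:R ^+ k.+1 :> R by exact: exprn_gt0.
have cM0 : 0 < coef_max k n lp r.
  rewrite /coef_max; apply: mulr_gt0; first exact: mulr_gt0 r0 (mulr_gt0 eK Mm0).
  by rewrite ltr0n !muln_gt0 expn_gt0 !muln_gt0 lp0 n0.
have W0 : 0 < n%:R * N0 * M%:R ^+ K.
  by apply: mulr_gt0 (mulr_gt0 nR N00) _; exact: exprn_gt0.
(* Squaring the factor [K + 3] avoids its square root in the standard deviations. *)
have pw x : 0 <= x -> (K + 3)%N%:R * n%:R ^+ k * x <= ((K + 3)%N%:R * N0) ^+ 2 * x.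
  move=> x0; apply: ler_wpM2r => //; rewrite exprMn N02 ler_wpM2r ?exprn_ge0 //.
  by rewrite expr2 ler_peMl // ltW.
have [||||||||e e1 He] := @random_signs R {ffun 'I_k.+1 -> 'I_n} (centers n lp) (lattice n lp) (coef psi)
  (fun b (x : lattice n lp) => plate R M b x)
  ((K + 3)%N%:R * N0 * coef_max k n lp r)
  ((K + 3)%N%:R * N0 * (2 ^+ K * M%:R ^+ k.+1))
  (gain_const * r * (n%:R * N0 * M%:R ^+ K))
  (mass_const * (n%:R * N0 * M%:R ^+ K)); last first.
- exists e => //; apply: le_trans He; rewrite lerD2l.
  rewrite le_eqVlt; apply/orP; left; apply/eqP; congr (_ * _).
  by field; rewrite !gt_eqF // ?exprn_gt0 // ?mass_const_gt0.
- rewrite card_prod card_ffun !card_ord natrM natrX /width natrM.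
  have HZ : (height k n lp)%:R <= (5 * k.+1 + 2)%N%:R * n%:R * M%:R :> R.
    by rewrite -!natrM ler_nat /height -/M leq_mul2r; apply/orP; right; nia.
  rewrite -/M exprMn /mass_const.
  have -> : M%:R ^+ K = M%:R ^+ k.+1 ^+ 2 * M%:R :> R by rewrite exprSr exprM.
  rewrite -/M in Mm0; set Mm := M%:R ^+ k.+1 in Mm0 *; set e3 := 3 ^+ k.+1; set e2 := 2 ^+ K in eK *.
  have e30 : 0 < e3 by rewrite exprn_gt0.
  rewrite (_ : e3 * Mm * _ * _ = (height k n lp)%:R * (e3 * Mm * ((K + 3)%N%:R * N0 * (e2 * Mm)))); last by ring.
  rewrite (_ : e3 * _ * _ * _ * _ = ((5 * k.+1 + 2)%N%:R * n%:R * M%:R) * (e3 * Mm * ((K + 3)%N%:R * N0 * (e2 * Mm)))); last by ring.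
  by apply: ler_wpM2r => //; apply: ltW; exact: mulr_gt0 (mulr_gt0 e30 Mm0) (mulr_gt0 (mulr_gt0 w0 N00) (mulr_gt0 eK Mm0)).
(* For each slope and each [a1] a single vertical center, the one from [coef_lower], is kept in the
   sum of squares. *)
- apply: (@le_trans _ _ (\sum_(a1 : {ffun 'I_k.+1 -> 'I_(2 * (k + 2) * n)})
      \sum_(b : {ffun 'I_k.+1 -> 'I_n}) coef_min k n lp r ^+ 2)); last first.
    rewrite (eq_bigr (fun a : centers n lp =>
      \sum_(b : {ffun 'I_k.+1 -> 'I_n}) coef psi b (a.1, a.2) ^+ 2)); last by case.
    rewrite -(pair_bigA _ (fun a1 a2 => \sum_(b : {ffun 'I_k.+1 -> 'I_n}) coef psi b (a1, a2) ^+ 2)) /=.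
    apply: ler_sum => a1 _; rewrite exchange_big /=; apply: ler_sum => b _.
    have [a2 Ha2] := coef_lower r0 psi_bound psi_supp psi_core b a1.
    rewrite (bigD1 a2) //=; apply: ler_wpDr; first by apply: sumr_ge0 => j _; exact: sqr_ge0.
    have c0 : 0 <= coef_min k n lp r.
      apply: mulr_ge0 => //; apply: mulr_ge0; first by rewrite divr_ge0 // ltW.
      by apply: exprn_ge0; rewrite divr_ge0.
    by rewrite ler_sqr ?nnegrE // (le_trans c0).
  rewrite !sumr_const !card_ffun !card_ord -[_ *+ (n ^ _)]mulr_natr -[_ *+ (_ ^ k.+1)]mulr_natr.
  rewrite /coef_min /coef_max /gain_const -/M.
  have -> : M%:R ^+ K = M%:R ^+ k.+1 ^+ 2 * M%:R :> R by rewrite exprSr exprM.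
  have ME : M%:R = 8 * (k + 2)%N%:R * n%:R * lp%:R :> R by rewrite /M /thickness !natrM.
  have MmE : M%:R ^+ k.+1 = 8 ^+ k.+1 * (k + 2)%N%:R ^+ k.+1 * n%:R ^+ k.+1 * lp%:R ^+ k.+1 :> R.
    by rewrite ME !exprMn.
  clearbody M; rewrite !natrX !natrM !natrX !natrM.
  rewrite (expr_div_n M%:R) [(4 * lp%:R) ^+ _]exprMn [(_ * n%:R) ^+ k.+1]exprMn [(2 * _) ^+ k.+1]exprMn.
  have nm : n%:R ^+ k.+1 = n%:R * N0 ^+ 2 by rewrite N02 exprS.
  move: MmE; rewrite nm; move=> MmE.
  have q0 : 0 < (k + 2)%N%:R :> R by rewrite ltr0n addn2.
  rewrite le_eqVlt; apply/orP; left; apply/eqP.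
  by apply: gain_identity => //; exact: exprn_gt0.
- by move=> x; apply: (le_trans (sum_plate_sq_le R n0 lp0 x)); rewrite [leRHS]exprMn; apply: pw; exact: sqr_ge0.
- move=> a; apply: (le_trans (sum_coef_sq_le r0 psi_bound psi_supp a)).
  by rewrite [leRHS]exprMn; apply: pw; exact: sqr_ge0.
- exact: mulr_gt0 mass_const_gt0 W0.
- exact: mulr_gt0 (mulr_gt0 gain_const_gt0 r0) W0.
- exact: mulr_gt0 (mulr_gt0 w0 N00) (mulr_gt0 eK Mm0).
- exact: mulr_gt0 (mulr_gt0 w0 N00) cM0.
Qed.

End Signs.

(** * Optimal transport on the line *)

Section Line.
Variable R : realFieldType.

Lemma telescope_lt (F : nat -> R) j N : (j <= N)%N ->
  \sum_(k < N) (k < j)%N%:R * (F k.+1 - F k) = F j - F 0%N.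
Proof.
elim: N j => [|N IH] j jN; first by rewrite big_ord0 (_ : j = 0%N) ?subrr //; lia.
rewrite big_ord_recr /=; move: jN; rewrite leq_eqVlt => /predU1P[->|jN].
  rewrite (eq_bigr (fun k : 'I_N => (k < N)%N%:R * (F k.+1 - F k))); last first.
    by move=> k _; rewrite ltn_ord ltnS ltnW.
  rewrite IH // ltnSn mul1r; ring.
by rewrite IH // (_ : (N < j)%N = false) ?mul0r ?addr0 //; lia.
Qed.

Lemma telescope_ge (F : nat -> R) j N : (j <= N)%N ->
  \sum_(k < N) (j <= k)%N%:R * (F k.+1 - F k) = F N - F j.
Proof.
move=> jN.
have -> : \sum_(k < N) (j <= k)%N%:R * (F k.+1 - F k) =
  \sum_(k < N) (k < N)%N%:R * (F k.+1 - F k) - \sum_(k < N) (k < j)%N%:R * (F k.+1 - F k).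
  rewrite -sumrB; apply: eq_bigr => k _.
  by rewrite ltn_ord; case: ltnP => _; rewrite ?mul1r ?mul0r ?subr0 ?subrr.
by rewrite !telescope_lt //; ring.
Qed.

(* Each [clamp k] increases only on [[t k, t k.+1]], and the clamps sum up to
   the clamp on [[t 0, t N]], so signed sums of them are 1-Lipschitz. *)
Definition clamp (t : nat -> R) k x := Num.min (Num.max x (t k)) (t k.+1) - t k.

Section Sorted.
Variables (t : nat -> R) (t_mono : {homo t : a b / (a <= b)%N >-> a <= b}).

Lemma clamp_mono k x y : x <= y -> clamp t k x <= clamp t k y.
Proof.
move=> xy; rewrite lerD2r le_min !ge_min lexx orbT andbT ge_max le_max xy /=.
by rewrite le_max lexx orbT.
Qed.

Lemma sum_clamp N x : \sum_(k < N) clamp t k x = Num.min (Num.max x (t 0%N)) (t N) - t 0%N.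
Proof.
elim: N => [|N IH]; first by rewrite big_ord0 min_r ?subrr // le_max lexx orbT.
rewrite big_ord_recr /= IH /clamp.
have := t_mono (leqnSn N); have := t_mono (leq0n N).
case: (leP x (t 0%N)); case: (leP x (t N)); rewrite ?minEle ?maxEle => *;
  repeat (case: ifP; try lra); lra.
Qed.

Lemma clamp_lip N (sg : nat -> R) x y : (forall k, `|sg k| <= 1) ->
  `|\sum_(k < N) sg k * clamp t k x - \sum_(k < N) sg k * clamp t k y| <= `|x - y|.
Proof.
move=> sg1; wlog yx : x y / y <= x.
  by move=> W; have [|/ltW] := leP y x; [exact: W|rewrite distrC (distrC x); exact: W].
rewrite -sumrB; apply: (le_trans (ler_norm_sum _ _ _)).
apply: (@le_trans _ _ (\sum_(k < N) (clamp t k x - clamp t k y))).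
  apply: ler_sum => k _; have c0 : 0 <= clamp t k x - clamp t k y by rewrite subr_ge0 clamp_mono.
  by rewrite -mulrBr normrM (ger0_norm c0) ler_piMl.
rewrite sumrB !sum_clamp ger0_norm ?subr_ge0 //.
have := t_mono (leq0n N).
rewrite ?minEle ?maxEle; repeat (case: ifP; try lra); lra.
Qed.

Lemma clamp_at k i : clamp t k (t i) = (k < i)%N%:R * (t k.+1 - t k).
Proof.
rewrite /clamp; case: ltnP => [ki|ik].
  by rewrite mul1r max_l ?min_r // t_mono // ltnW.
rewrite mul0r max_r ?t_mono // min_l ?subrr ?t_mono //.
Qed.

Lemma dist_gaps N i j : (i <= N)%N -> (j <= N)%N ->
  `|t i - t j| = \sum_(k < N)
    ((i <= k)%N%:R * (k < j)%N%:R + (k < i)%N%:R * (j <= k)%N%:R) * (t k.+1 - t k).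
Proof.
wlog ij : i j / (i <= j)%N.
  move=> W iN jN; case/orP: (leq_total i j) => h; first exact: W.
  rewrite distrC W //; apply: eq_bigr => k _; congr (_ * _); rewrite addrC.
  by congr (_ + _); rewrite mulrC.
move=> iN jN; rewrite distrC ger0_norm ?subr_ge0 ?t_mono //.
transitivity (\sum_(k < N) (k < j)%N%:R * (t k.+1 - t k) -
              \sum_(k < N) (k < i)%N%:R * (t k.+1 - t k)).
  by rewrite !telescope_lt //; ring.
rewrite -sumrB; apply: eq_bigr => k _; rewrite -mulrBl; congr (_ * _).
case: (leqP i k) => ik; case: (leqP j k) => jk; rewrite /=; try ring.
by move: (leq_ltn_trans (leq_trans ij jk) ik); rewrite ltnn.
Qed.

(* The monotone coupling: its distribution function is the minimum of the two
   marginal distribution functions. *)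
Lemma sorted_coupling N (mu nu : nat -> R) (S : R) :
  (forall i, 0 <= mu i) -> (forall i, 0 <= nu i) ->
  \sum_(i < N) mu i = \sum_(i < N) nu i ->
  (forall g : R -> R, (forall u v, `|g u - g v| <= `|u - v|) ->
     \sum_(i < N) (mu i - nu i) * g (t i) <= S) ->
  exists gam : nat -> nat -> R, [/\ forall i j, 0 <= gam i j,
    forall i, (i < N)%N -> \sum_(j < N) gam i j = mu i,
    forall j, (j < N)%N -> \sum_(i < N) gam i j = nu j &
    \sum_(i < N) \sum_(j < N) gam i j * `|t i - t j| <= S].
Proof.
move=> mu0 nu0 mass dual.
pose A k := \sum_(i < k) mu i; pose B k := \sum_(i < k) nu i.
have AS k : A k.+1 - A k = mu k by rewrite /A big_ord_recr /=; ring.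
have BS k : B k.+1 - B k = nu k by rewrite /B big_ord_recr /=; ring.
have A0 : A 0%N = 0 by rewrite /A big_ord0.
have B0 : B 0%N = 0 by rewrite /B big_ord0.
have mono (C : nat -> R) : (forall k, 0 <= C k.+1 - C k) -> forall k l, (k <= l)%N -> C k <= C l.
  by move=> HC; apply: (homo_leq (r := fun a b : R => a <= b)) => [//|y x z|k]; [exact: le_trans|rewrite -subr_ge0].
have Am := mono A (fun k => (eq_ind_r (fun z => 0 <= z) (mu0 k) (AS k))).
have Bm := mono B (fun k => (eq_ind_r (fun z => 0 <= z) (nu0 k) (BS k))).
have ABN : A N = B N by [].
pose H i j := Num.min (A i) (B j).
pose gam i j := (H i.+1 j.+1 - H i j.+1) - (H i.+1 j - H i j).
have H0r i : H i 0%N = 0 by rewrite /H B0 min_r // -A0 Am.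
have H0l j : H 0%N j = 0 by rewrite /H A0 min_l // -B0 Bm.
have HNr i : (i <= N)%N -> H i N = A i by move=> iN; rewrite /H min_l // -ABN Am.
have HNl j : (j <= N)%N -> H N j = B j by move=> jN; rewrite /H min_r // ABN Bm.
have gamC i j : gam i j = (H i.+1 j.+1 - H i.+1 j) - (H i j.+1 - H i j) by rewrite /gam; ring.
have row (F : nat -> nat -> R) i : \sum_(j < N) (F i j.+1 - F i j) = F i N - F i 0%N.
  by rewrite -(telescope_lt (F i) (leqnn N)); apply: eq_bigr => j _; rewrite ltn_ord mul1r.
exists gam; split.
- move=> i j; rewrite /gam /H; have := mu0 i; have := nu0 j; rewrite -AS -BS.
  by rewrite !minEle => *; repeat (case: ifP; try lra); lra.
- move=> i iN; rewrite (row (fun i j => H i.+1 j - H i j)) !HNr // ?H0r; last exact: ltnW.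
  by rewrite AS subrr subr0.
- move=> j jN; under eq_bigr do rewrite gamC.
  rewrite (row (fun j i => H i j.+1 - H i j)) !HNl // ?H0l; last exact: ltnW.
  by rewrite BS subrr subr0.
(* The cost is counted gap by gap: the mass crossing the gap [k] in the two directions is
   [A + B - 2 * min A B = |A - B|], taken at [k.+1]. *)
have cost : \sum_(i < N) \sum_(j < N) gam i j * `|t i - t j| =
  \sum_(k < N) `|A k.+1 - B k.+1| * (t k.+1 - t k).
  transitivity (\sum_(k < N) (\sum_(i < N) \sum_(j < N)
    ((i <= k)%N%:R * ((k < j)%N%:R * gam i j) + (j <= k)%N%:R * ((k < i)%N%:R * gam i j)))
     * (t k.+1 - t k)).
    under [RHS]eq_bigr do rewrite mulr_suml.
    rewrite [RHS]exchange_big /=; apply: eq_bigr => i _.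
    under [RHS]eq_bigr do rewrite mulr_suml.
    rewrite [RHS]exchange_big /=; apply: eq_bigr => j _.
    rewrite (@dist_gaps N) ?(ltnW (ltn_ord _)) // mulr_sumr; apply: eq_bigr => k _.
    by ring.
  apply: eq_bigr => k _; congr (_ * _).
  under eq_bigr do rewrite big_split /=.
  rewrite big_split /= [X in _ + X]exchange_big /=.
  have -> : \sum_(i < N) \sum_(j < N) (i <= k)%N%:R * ((k < j)%N%:R * gam i j) =
     A k.+1 - H k.+1 k.+1.
    under eq_bigr => i _.
      rewrite -mulr_sumr (telescope_ge (fun j => H i.+1 j - H i j)) //.
      rewrite (_ : _ - _ = (H i.+1 N - H i.+1 k.+1) - (H i N - H i k.+1)); last by ring.
      rewrite -ltnS.
      over.
    rewrite /= (telescope_lt (fun i => H i N - H i k.+1)) // HNr // !H0l; ring.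
  have -> : \sum_(j < N) \sum_(i < N) (j <= k)%N%:R * ((k < i)%N%:R * gam i j) =
     B k.+1 - H k.+1 k.+1.
    under eq_bigr => j _.
      rewrite -mulr_sumr; under eq_bigr do rewrite gamC.
      rewrite (telescope_ge (fun i => H i j.+1 - H i j)) //.
      rewrite (_ : _ - _ = (H N j.+1 - H k.+1 j.+1) - (H N j - H k.+1 j)); last by ring.
      rewrite -ltnS.
      over.
    rewrite /= (telescope_lt (fun j => H N j - H k.+1 j)) // HNl // !H0r; ring.
  by rewrite /H minEle; case: leP => h; [rewrite ler0_norm|rewrite gtr0_norm]; lra.
rewrite cost.
(* The slopes of a Kantorovich potential: the test function rises or falls on each gap according to
   the sign of [B - A], and its pairing with [mu - nu] equals the cost. *)
pose sg k : R := Num.sg (B k.+1 - A k.+1).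
have := dual _ (fun u v => @clamp_lip N sg u v (fun k => _)).
have sg1 k : `|sg k| <= 1 by rewrite normr_sg; case: (_ != _) => //=.
move=> /(_ sg1); apply: le_trans.
under [leRHS]eq_bigr do rewrite mulr_sumr.
rewrite exchange_big /= le_eqVlt; apply/orP; left; apply/eqP; apply: eq_bigr => k _.
have -> : `|A k.+1 - B k.+1| * (t k.+1 - t k) =
   sg k * (t k.+1 - t k) * \sum_(i < N) (k < i)%N%:R * (mu i - nu i).
  rewrite distrC normrEsg -/(sg k).
  have -> : \sum_(i < N) (k < i)%N%:R * (mu i - nu i) =
    \sum_(i < N) (k < i)%N%:R * ((A i.+1 - B i.+1) - (A i - B i)).
    by apply: eq_bigr => i _; rewrite -AS -BS; congr (_ * _); ring.
  by rewrite (telescope_ge (fun i => A i - B i)) // ABN; ring.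
by rewrite mulr_sumr; apply: eq_bigr => i _; rewrite clamp_at; ring.
Qed.

End Sorted.

Lemma line_coupling (I : finType) (T mu nu : I -> R) (S : R) :
  (forall i, 0 <= mu i) -> (forall i, 0 <= nu i) ->
  \sum_i mu i = \sum_i nu i ->
  (forall g : R -> R, (forall u v, `|g u - g v| <= `|u - v|) ->
     \sum_i (mu i - nu i) * g (T i) <= S) ->
  exists gam : I -> I -> R, [/\ forall i j, 0 <= gam i j,
    forall i, \sum_j gam i j = mu i,
    forall j, \sum_i gam i j = nu j &
    \sum_i \sum_j gam i j * `|T i - T j| <= S].
Proof.
move=> mu0 nu0 mass dual.
case: (pickP (@predT I)) => [i0 _|I0]; last first.
  exists (fun _ _ => 0); split => // [i|i|]; [by have := I0 i|by have := I0 i|].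
  have := dual (fun=> 0); rewrite !big_pred0 //; apply => u v.
  by rewrite subrr normr0.
pose s := sort (fun i j => T i <= T j) (enum I).
have s_uniq : uniq s by rewrite sort_uniq enum_uniq.
have sE i : i \in s by rewrite mem_sort mem_enum.
have s_sorted : sorted (fun i j => T i <= T j) s.
  by apply: sort_sorted => i j; exact: le_total.
have sumE (F : I -> R) : \sum_i F i = \sum_(k < size s) F (nth (last i0 s) s k).
  rewrite -(big_mkord predT (fun k => F (nth (last i0 s) s k))).
  rewrite -(big_nth (last i0 s) predT F) -[LHS]big_enum /=.
  by apply: perm_big; rewrite perm_sym perm_sort.
pose x k := nth (last i0 s) s k.
(* The default value [last i0 s] continues the sorted sequence as a constant, so it is monotone on
   all natural numbers. *)
have t_mono : {homo (fun k => T (x k)) : a b / (a <= b)%N >-> a <= b}.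
  apply: (homo_leq (r := fun a b : R => a <= b)) => [//|b a c|k]; first exact: le_trans.
  have [ks|ks] := ltnP k.+1 (size s).
    by apply: (sorted_ltn_nth (leT := fun i j => T i <= T j)) => //; [move=> ? ? ?; exact: le_trans|exact: ltnW].
  rewrite /x [nth _ s k.+1]nth_default //.
  have [ks'|ks'] := ltnP k (size s); last by rewrite nth_default.
  have -> : last i0 s = nth (last i0 s) s k.
    have -> : k = (size s).-1 by lia.
    by rewrite nth_last; case: (s) ks'.
  by rewrite (set_nth_default (last i0 s)).
have [||||gam [g0 gr gc gcost]] := @sorted_coupling _ t_mono (size s) (mu \o x) (nu \o x) S.
- by move=> i; exact: mu0.
- by move=> i; exact: nu0.
- by rewrite -!sumE.
- by move=> g /dual; rewrite sumE.
have xi i : x (index i s) = i by rewrite /x nth_index.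
have ix (k : 'I_(size s)) : index (x k) s = k by rewrite /x index_uniq.
exists (fun i j => gam (index i s) (index j s)); split => //.
- move=> i; rewrite sumE -[RHS](congr1 mu (xi i)) -[RHS](gr (index i s)) ?index_mem //.
  by apply: eq_bigr => k _; rewrite ix.
- move=> j; rewrite sumE -[RHS](congr1 nu (xi j)) -[RHS](gc (index j s)) ?index_mem //.
  by apply: eq_bigr => k _; rewrite ix.
apply: le_trans gcost; rewrite sumE le_eqVlt; apply/orP; left; apply/eqP.
apply: eq_bigr => k _; rewrite sumE; apply: eq_bigr => l _.
by rewrite -!/(x _) !ix.
Qed.

End Line.

(** * From signed weights to probability measures *)

Section FiniteProbability.
Context (disp : measure_display) (T : measurableType disp) (R : realType).

Lemma finite_probability (I : finType) (w : I -> R) (x : I -> T) :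
  (forall i, 0 <= w i) -> \sum_i w i = 1 ->
  exists P : probability T R,
    (forall A, P A = (\sum_i w i * \1_A (x i))%:E) /\
    (forall f : T -> R, measurable_fun setT f -> (forall y, 0 <= f y) ->
       (\int[P]_y (f y)%:E = (\sum_i w i * f (x i))%:E)%E).
Proof.
move=> w0 w1.
have [i0 _|I0] := pickP (@predT I); last first.
  by move: w1; rewrite big_pred0 // => /esym/eqP; rewrite oner_eq0.
pose e k := nth i0 (enum I) k.
have sumE (F : I -> R) : (\sum_(k < #|I|) (F (e k))%:E = (\sum_i F i)%:E)%E.
  rewrite sumEFin; congr (_%:E).
  rewrite -(big_mkord predT (fun k => F (e k))) cardE.
  by rewrite -(big_nth i0 predT F) big_enum.
pose m_ k : {measure set T -> \bar R} := mscale (NngNum (w0 (e k))) (dirac (x (e k))).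
pose P0 : {measure set T -> \bar R} := msum m_ #|I|.
have P0E A : P0 A = (\sum_i w i * \1_A (x i))%:E.
  rewrite -(sumE (fun i => w i * \1_A (x i))) /P0 /= /msum.
  by apply: eq_bigr => k _; rewrite /m_ /= /mscale /= /dirac EFinM.
have P0T : P0 setT = 1%E.
  by rewrite P0E -w1; congr (_%:E); apply: eq_bigr => i _; rewrite indicT mulr1.
pose PP := Measure_isProbability.Build _ _ _ (msum m_ #|I|) P0T.
pose P : probability T R := HB.pack (msum m_ #|I|) PP.
exists P; split; first exact: P0E.
move=> f mf f0.
have mfE : measurable_fun setT (fun y => (f y)%:E) by exact/measurable_EFinP.
have f0E y : (0 <= (f y)%:E)%E by rewrite lee_fin.
rewrite (_ : (\int[P]_y _)%E = (\int[msum m_ #|I|]_y (f y)%:E)%E) //.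
rewrite ge0_integral_measure_sum //.
rewrite -(sumE (fun i => w i * f (x i))); apply: eq_bigr => k _.
by rewrite ge0_integral_mscale //= integral_dirac //= diracT mul1e EFinM.
Qed.

End FiniteProbability.

Section Interface.
Context (R : realType) (d : nat).
Implicit Types (mu nu : probability (borel_rV R d) R).

Lemma continuous_measurable_borel_rV (f : 'rV[R]_d -> R) : continuous f ->
  measurable_fun [set: borel_rV R d] (f : borel_rV R d -> R).
Proof.
move=> cf; apply: (measurability _ (RGenOpens.measurableE R)).
move=> _ [_ [a [b ->] <-]]; rewrite setTI; apply: sub_sigma_algebra.
by move/continuousP : cf; apply; exact: interval_open.
Qed.

Lemma measurable_enorm_sub :
  measurable_fun [set: borel_rV R d * borel_rV R d]
    (fun z : borel_rV R d * borel_rV R d => enorm ((z.1 : 'rV[R]_d) - z.2)).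
Proof.
have mc i : measurable_fun [set: borel_rV R d] (fun x : borel_rV R d => (x : 'rV[R]_d) ord0 i).
  by apply: (@continuous_measurable_borel_rV (fun x : 'rV[R]_d => x ord0 i)) => x; exact: coord_continuous.
apply: measurableT_comp; first by apply: continuous_measurable_fun; exact: sqrt_continuous.
rewrite /dotp; apply: measurable_sum => i.
under eq_fun do rewrite !mxE -expr2.
apply: measurable_funX; apply: measurable_funB.
  exact: (measurableT_comp (mc i) measurable_fst).
exact: (measurableT_comp (mc i) measurable_snd).
Qed.

(** The easy half of Kantorovich duality. Adding [r] makes the integrands nonnegative, so no
    integrability of the distance under the coupling is involved. *)
Lemma W1_ge mu nu (phi : 'rV[R]_d -> R) (r a b : R) :
  continuous phi -> (forall x, `|phi x| <= r) ->
  (forall x y, `|phi x - phi y| <= enorm (x - y)) ->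
  (\int[mu]_x (phi x + r)%:E = a%:E)%E -> (\int[nu]_x (phi x + r)%:E = b%:E)%E ->
  ((a - b)%:E <= W1 mu nu)%E.
Proof.
move=> cphi phir lip Ea Eb; rewrite /W1 /wasserstein1.
apply: le_ereal_inf_tmp => _ [gam [g1 g2] <-].
have mphi : measurable_fun [set: borel_rV R d] (fun x : borel_rV R d => phi x + r).
  by apply: measurable_funD => //; exact: continuous_measurable_borel_rV.
have phi0 x : 0 <= phi x + r by have := phir x; rewrite ler_norml => /andP[]; lra.
have mphiE : measurable_fun [set: borel_rV R d] (fun x : borel_rV R d => (phi x + r)%:E).
  exact/measurable_EFinP.
have H1 : (\int[gam]_z (phi z.1 + r)%:E = a%:E)%E.
  rewrite -Ea -(@ge0_integral_pushforward _ _ _ _ R fst measurable_fst gam setT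
    (fun x => (phi x + r)%:E)) //.
    apply: eq_measure_integral => A mA _; apply: etrans _ (g1 A mA).
    change (gam (fst @^-1` A) = gam (A `*` setT)).
    by congr (gam _); apply/seteqP; split => z /=; [split|case].
  by move=> y _; rewrite lee_fin.
have H2 : (\int[gam]_z (phi z.2 + r)%:E = b%:E)%E.
  rewrite -Eb -(@ge0_integral_pushforward _ _ _ _ R snd measurable_snd gam setT
    (fun x => (phi x + r)%:E)) //.
    apply: eq_measure_integral => A mA _; apply: etrans _ (g2 A mA).
    change (gam (snd @^-1` A) = gam (setT `*` A)).
    by congr (gam _); apply/seteqP; split => z /=; [split|case].
  by move=> y _; rewrite lee_fin.
have e0 (x : 'rV[R]_d) : 0 <= enorm x by exact: sqrtr_ge0.
have mdist : measurable_fun [set: borel_rV R d * borel_rV R d]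
    (fun z : borel_rV R d * borel_rV R d => (enorm ((z.1 : 'rV[R]_d) - z.2))%:E).
  by apply/measurable_EFinP; exact: measurable_enorm_sub.
have mphi2 : measurable_fun [set: borel_rV R d * borel_rV R d]
    (fun z : borel_rV R d * borel_rV R d => (phi z.2 + r)%:E).
  exact: (measurableT_comp mphiE measurable_snd).
have mphi1 : measurable_fun [set: borel_rV R d * borel_rV R d]
    (fun z : borel_rV R d * borel_rV R d => (phi z.1 + r)%:E).
  exact: (measurableT_comp mphiE measurable_fst).
rewrite EFinB leeBlDr // -H1 -H2.
rewrite -ge0_integralD //; last 2 first.
- by move=> z _; rewrite lee_fin.
- by move=> z _; rewrite lee_fin.
apply: ge0_le_integral => //.
- by move=> z _; rewrite lee_fin.
- by apply: emeasurable_funD.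
move=> z _; rewrite -EFinD lee_fin.
by have := le_trans (ler_norm _) (lip z.1 z.2); lra.
Qed.

(** The hard half of duality, which on the line and for finitely many atoms is [line_coupling]. *)
Lemma W1_line_le (I : finType) (T : I -> R) (wmu wnu : I -> R) (S : R)
    (mu nu : probability R R) :
  (forall i, 0 <= wmu i) -> (forall i, 0 <= wnu i) ->
  \sum_i wmu i = 1 -> \sum_i wnu i = 1 ->
  (forall A, measurable A -> mu A = (\sum_i wmu i * \1_A (T i))%:E) ->
  (forall A, measurable A -> nu A = (\sum_i wnu i * \1_A (T i))%:E) ->
  (forall g : R -> R, (forall u v, `|g u - g v| <= `|u - v|) ->
     \sum_i (wmu i - wnu i) * g (T i) <= S) ->
  (W1_line mu nu <= S%:E)%E.
Proof.
move=> mu0 nu0 mu1 nu1 muE nuE dual.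
have [gam [gam0 gamr gamc gamS]] := line_coupling mu0 nu0 (etrans mu1 (esym nu1)) dual.
have [||P [PE Pint]] := @finite_probability _ (R * R)%type R (I * I)%type (fun p => gam p.1 p.2)
  (fun p => (T p.1, T p.2)).
- by move=> p; exact: gam0.
- rewrite -(pair_bigA _ (fun i j => gam i j)) /= -mu1.
  by apply: eq_bigr => i _; rewrite gamr.
apply: ge_ereal_inf; exists (\int[P]_z (`|z.1 - z.2|)%:E)%E.
  exists P => //; split => A mA.
    rewrite PE muE //; congr (_%:E).
    rewrite -(pair_bigA _ (fun i j => gam i j * \1_(A `*` setT) (T i, T j))) /=.
    apply: eq_bigr => i _; rewrite -gamr mulr_suml; apply: eq_bigr => j _.
    by congr (_ * _); rewrite !indicE in_setX /= in_setT andbT.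
  rewrite PE nuE //; congr (_%:E).
  rewrite -(pair_bigA _ (fun i j => gam i j * \1_(setT `*` A) (T i, T j))) /= exchange_big /=.
  apply: eq_bigr => j _; rewrite -gamc mulr_suml; apply: eq_bigr => i _.
  by congr (_ * _); rewrite !indicE in_setX /= in_setT.
rewrite Pint //.
  rewrite lee_fin; apply: le_trans gamS; rewrite pair_bigA /=.
  exact: lexx.
apply: measurableT_comp; first (apply: continuous_measurable_fun; exact: norm_continuous).
by apply: measurable_funB; [exact: measurable_fst|exact: measurable_snd].
Qed.

(** The normalised Jordan decomposition: [|f| + f] and [|f| - f] are twice the positive and negative
    parts of [f], and [\sum f = 0] gives them equal mass. The difference of the weights is
    [2 * f / B], hence the factors 2. *)
Lemma measures_of_signed_weights (I : finType) (pos : I -> 'rV[R]_d) (f : I -> R)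
    (phi : 'rV[R]_d -> R) (rad r S : R) :
  (forall i, enorm (pos i) <= rad) ->
  \sum_i f i = 0 -> 0 < \sum_i `|f i| ->
  continuous phi -> (forall x, `|phi x| <= r) ->
  (forall x y, `|phi x - phi y| <= enorm (x - y)) ->
  (forall theta, esphere theta ->
    forall g : R -> R, (forall u v, `|g u - g v| <= `|u - v|) ->
      \sum_i f i * g (dotp theta (pos i)) <= S) ->
  exists mu nu : probability (borel_rV R d) R,
    [/\ supported_on mu (ecball rad), supported_on nu (ecball rad),
      ((2 * (\sum_i f i * phi (pos i)) / \sum_i `|f i|)%:E <= W1 mu nu)%E &
      (max_sliced_W1 mu nu <= (2 * S / \sum_i `|f i|)%:E)%E].
Proof.
move=> posr f0 absf cphi phir lip dual.
set B := \sum_i `|f i|.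
have B0 : B != 0 by rewrite gt_eqF.
pose wp i := (`|f i| + f i) / B; pose wn i := (`|f i| - f i) / B.
have wp0 i : 0 <= wp i.
  apply: divr_ge0; last exact: ltW.
  by have := ler_norm (- f i); rewrite normrN; lra.
have wn0 i : 0 <= wn i.
  apply: divr_ge0; last exact: ltW.
  by have := ler_norm (f i); lra.
have wp1 : \sum_i wp i = 1.
  by rewrite -mulr_suml big_split /= f0 addr0 divff.
have wn1 : \sum_i wn i = 1.
  by rewrite -mulr_suml sumrB f0 subr0 divff.
have wB i : wp i - wn i = 2 * f i / B by rewrite /wp /wn; field.
have [mu [muE muint]] := @finite_probability _ (borel_rV R d) R I wp pos wp0 wp1.
have [nu [nuE nuint]] := @finite_probability _ (borel_rV R d) R I wn pos wn0 wn1.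
have mphi : measurable_fun [set: borel_rV R d] (fun x : borel_rV R d => phi x + r).
  by apply: measurable_funD => //; exact: continuous_measurable_borel_rV.
have phi0 x : 0 <= phi x + r by have := phir x; rewrite ler_norml => /andP[]; lra.
exists mu, nu; split.
- rewrite /supported_on muE -wp1; congr (_%:E); apply: eq_bigr => i _.
  by rewrite indicE (mem_set (posr i : ecball rad (pos i))) mulr1.
- rewrite /supported_on nuE -wn1; congr (_%:E); apply: eq_bigr => i _.
  by rewrite indicE (mem_set (posr i : ecball rad (pos i))) mulr1.
- have := W1_ge cphi phir lip (muint _ mphi phi0) (nuint _ mphi phi0).
  apply: le_trans; rewrite lee_fin -sumrB le_eqVlt; apply/orP; left; apply/eqP.
  rewrite mulrAC mulr_sumr.
  transitivity (\sum_i (wp i - wn i) * (phi (pos i) + r)).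
    transitivity (\sum_i (wp i - wn i) * phi (pos i)).
      by apply: eq_bigr => i _; rewrite wB; ring.
    under [RHS]eq_bigr do rewrite mulrDr.
    by rewrite big_split /= -mulr_suml sumrB wp1 wn1 subrr mul0r addr0.
  by apply: eq_bigr => i _; rewrite mulrBl.
apply: ge_ereal_sup => _ [theta th1 <-].
apply: (@W1_line_le I (fun i => dotp theta (pos i)) wp wn) => //.
- by move=> A mA; exact: (muE (slice theta @^-1` A)).
- by move=> A mA; exact: (nuE (slice theta @^-1` A)).
move=> g gl; rewrite mulrAC.
have -> : \sum_i (wp i - wn i) * g (dotp theta (pos i)) =
  2 / B * \sum_i f i * g (dotp theta (pos i)).
  by rewrite mulr_sumr; apply: eq_bigr => i _; rewrite wB; ring.
by apply: ler_wpM2l; [rewrite divr_ge0 // ltW|exact: dual].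
Qed.

Lemma enormZ (t : R) (x : 'rV[R]_d) : 0 <= t -> enorm (t *: x) = t * enorm x.
Proof.
move=> t0; rewrite /enorm.
have -> : dotp (t *: x) (t *: x) = t ^+ 2 * dotp x x.
  by rewrite /dotp mulr_sumr; apply: eq_bigr => i _; rewrite !mxE; ring.
by rewrite sqrtrM ?sqr_ge0 // sqrtr_sqr ger0_norm.
Qed.

Lemma scaled_measures_of_signed_weights (I : finType) (pos : I -> 'rV[R]_d) (f : I -> R)
    (phi : 'rV[R]_d -> R) (rad r S t : R) : 0 < t ->
  (forall i, enorm (pos i) <= rad) ->
  \sum_i f i = 0 -> 0 < \sum_i `|f i| ->
  continuous phi -> (forall x, `|phi x| <= r) ->
  (forall x y, `|phi x - phi y| <= enorm (x - y)) ->
  (forall theta, esphere theta ->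
    forall g : R -> R, (forall u v, `|g u - g v| <= `|u - v|) ->
      \sum_i f i * g (dotp theta (pos i)) <= S) ->
  exists mu nu : probability (borel_rV R d) R,
    [/\ supported_on mu (ecball (t * rad)), supported_on nu (ecball (t * rad)),
      ((t * (2 * (\sum_i f i * phi (pos i)) / \sum_i `|f i|))%:E <= W1 mu nu)%E &
      (max_sliced_W1 mu nu <= (t * (2 * S / \sum_i `|f i|))%:E)%E].
Proof.
move=> t0 posr f0 absf cphi phir lip dual; have tn0 : t != 0 by rewrite gt_eqF.
have Hpos i : enorm (t *: pos i) <= t * rad by rewrite (enormZ _ (ltW t0)) ler_pM2l.
have Hcont : continuous (fun x : 'rV[R]_d => t * phi (t^-1 *: x)).
  move=> x; apply: cvgMl_tmp; first exact: nbhs_filter.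
  have cs : continuous (fun y : 'rV[R]_d => t^-1 *: y) by exact: scaler_continuous.
  exact: (cvg_comp _ _ (cs x) (cphi _)).
have Hbound x : `|t * phi (t^-1 *: x)| <= t * r.
  by rewrite normrM (gtr0_norm t0) ler_pM2l.
have Hlip x y : `|t * phi (t^-1 *: x) - t * phi (t^-1 *: y)| <= enorm (x - y).
  rewrite -mulrBr normrM (gtr0_norm t0); apply: (le_trans (ler_wpM2l (ltW t0) (lip _ _))).
  have ti0 : 0 <= t^-1 by rewrite invr_ge0 ltW.
  by rewrite -scalerBr (enormZ _ ti0) mulrA divff // mul1r.
have Hdual theta : esphere theta -> forall g : R -> R,
    (forall u v, `|g u - g v| <= `|u - v|) ->
    \sum_i f i * g (dotp theta (t *: pos i)) <= t * S.
  (* The dilation is undone on the line: [u |-> t^-1 * g (t * u)] is again 1-Lipschitz. *)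
  move=> th1 g gl; have := dual theta th1 (fun u => t^-1 * g (t * u)).
  have -> : \sum_i f i * (t^-1 * g (t * dotp theta (pos i))) =
     t^-1 * \sum_i f i * g (dotp theta (t *: pos i)).
    rewrite mulr_sumr; apply: eq_bigr => i _; rewrite mulrCA; congr (_ * (_ * g _)).
    by rewrite /dotp mulr_sumr; apply: eq_bigr => j _; rewrite mxE; ring.
  move=> H; rewrite -[leLHS]mul1r -(divff tn0) -mulrA ler_pM2l //; apply: H => u v.
  rewrite -mulrBr normrM normfV (gtr0_norm t0) mulrC ler_pdivrMr //.
  by apply: (le_trans (gl _ _)); rewrite -mulrBr normrM (gtr0_norm t0) mulrC.
have [mu [nu [H1 H2 H3 H4]]] := measures_of_signed_weights Hpos f0 absf Hcont Hbound Hlip Hdual.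
exists mu, nu; split=> //.
  apply: le_trans H3; rewrite lee_fin le_eqVlt; apply/orP; left; apply/eqP.
  have -> : \sum_i f i * (t * phi (t^-1 *: (t *: pos i))) = t * \sum_i f i * phi (pos i).
    by rewrite mulr_sumr; apply: eq_bigr => i _; rewrite scalerA mulVf // scale1r mulrCA.
  by ring.
apply: (le_trans H4); rewrite lee_fin le_eqVlt; apply/orP; left; apply/eqP.
by ring.
Qed.

End Interface.

(** * The construction *)

Section SpikeSum.
Context (R : realType) (V : normedModType R) (A : finType).
Variables (c : A -> V) (sg : A -> R) (r : R).
Hypotheses (r_gt0 : 0 < r) (sg_le1 : forall a, `|sg a| <= 1).
Hypothesis c_sep : forall a b, a != b -> 2 * r <= `|c a - c b|.

(** For row vectors [V] carries the sup norm: the supports are boxes that fit the lattice, and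
    1-Lipschitz for the sup norm implies 1-Lipschitz for the Euclidean norm. *)
Definition spike (a : A) (x : V) : R := Num.max 0 (r - `|x - c a|).
Definition spike_sum (x : V) : R := \sum_a sg a * spike a x.

Lemma spike_bound a x : 0 <= spike a x <= r.
Proof. by rewrite /spike le_max lexx ge_max (ltW r_gt0) /= gerBl normr_ge0. Qed.

Lemma spike_ge a x : r - `|x - c a| <= spike a x.
Proof. by rewrite /spike le_max lexx orbT. Qed.

Lemma spike_supp a x : spike a x != 0 -> spike a x = r - `|x - c a| /\ `|x - c a| < r.
Proof.
rewrite /spike; case: (leP 0 (r - _)) => h h0; last by rewrite eqxx in h0.
by split=> //; rewrite -subr_gt0 lt_def h0.
Qed.

Lemma spike_lip a x y : `|spike a x - spike a y| <= `|x - y|.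
Proof.
have H u v : spike a u - spike a v <= `|u - v|.
  have [/andP[u0 _] /andP[v0 _]] := (spike_bound a u, spike_bound a v).
  have [->|/spike_supp[-> _]] := eqVneq (spike a u) 0.
    by have := normr_ge0 (u - v); lra.
  have := spike_ge a v; have := ler_distD u v (c a); rewrite [`|v - u|]distrC; lra.
by rewrite ler_norml H andbT; have := H y x; rewrite distrC; lra.
Qed.

Lemma spike_uniq a b x : spike a x != 0 -> spike b x != 0 -> a = b.
Proof.
move=> /spike_supp[_ ha] /spike_supp[_ hb]; apply: contraTeq isT => ab.
have := c_sep ab; have := ler_distD x (c a) (c b); rewrite [`|c a - x|]distrC; lra.
Qed.

Lemma spike_sum1 a x : spike a x != 0 -> spike_sum x = sg a * spike a x.
Proof.
move=> ax; rewrite /spike_sum (bigD1 a) //= big1 ?addr0 // => b ba.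
have [->|bx] := eqVneq (spike b x) 0; first by rewrite mulr0.
by rewrite (spike_uniq ax bx) eqxx in ba.
Qed.

Lemma spike_sum0 x : (forall a, spike a x = 0) -> spike_sum x = 0.
Proof. by move=> x0; rewrite /spike_sum big1 // => a _; rewrite x0 mulr0. Qed.

Lemma spike_sumP x : (forall a, spike a x = 0) \/ exists a, spike a x != 0.
Proof.
case: (pickP (fun a => spike a x != 0)) => [a|] h; [by right; exists a|left => a].
by apply/eqP; have := h a => /negbFE.
Qed.

Lemma sg_mul_le a (u : R) : `|sg a * u| <= `|u|.
Proof. by rewrite normrM ler_piMl. Qed.

Lemma spike_sum_bound x : `|spike_sum x| <= r.
Proof.
have [/spike_sum0->|[a /spike_sum1->]] := spike_sumP x; first by rewrite normr0 ltW.
apply: le_trans (sg_mul_le _ _) _.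
by case/andP: (spike_bound a x) => h1 h2; rewrite ger0_norm.
Qed.

(** The signs do not double the Lipschitz constant: for points under different spikes,
    [(r - |x - c a|) + (r - |y - c b|)] is at most [|x - y|], since the centers are [2 * r]
    apart. *)
Lemma spike_sum_lip x y : `|spike_sum x - spike_sum y| <= `|x - y|.
Proof.
have [x0|[a ax]] := spike_sumP x; have [y0|[b by_]] := spike_sumP y.
- by rewrite !spike_sum0 // subrr normr0.
- rewrite spike_sum0 // (spike_sum1 by_) sub0r normrN.
  apply: le_trans (sg_mul_le _ _) _.
  by have := spike_lip b x y; rewrite x0 sub0r normrN.
- rewrite [spike_sum y]spike_sum0 // (spike_sum1 ax) subr0.
  apply: le_trans (sg_mul_le _ _) _.
  by have := spike_lip a x y; rewrite y0 subr0.
- rewrite (spike_sum1 ax) (spike_sum1 by_).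
  have [ab|ab] := eqVneq a b.
    by rewrite -ab -mulrBr; apply: le_trans (sg_mul_le _ _) (spike_lip _ _ _).
  apply: (le_trans (ler_normB _ _)).
  apply: (le_trans (lerD (sg_mul_le _ _) (sg_mul_le _ _))).
  have [/andP[h1 _] /andP[h2 _]] := (spike_bound a x, spike_bound b y).
  rewrite !ger0_norm //; case: (spike_supp ax) => -> _; case: (spike_supp by_) => -> _.
  have := c_sep ab; have := ler_distD x (c a) (c b); have := ler_distD y x (c b).
  rewrite [`|c a - x|]distrC; lra.
Qed.

Lemma spike_sum_continuous : continuous spike_sum.
Proof.
move=> x; apply/cvgrPdist_lt => e e0; near=> y.
apply: le_lt_trans (spike_sum_lip x y) _.
by near: y; apply: cvgr_dist_lt e0; exact: cvg_id.
Unshelve. all: by end_near. Qed.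

End SpikeSum.

Section Norms.
Context (R : realType) (d : nat).
Implicit Types v : 'rV[R]_d.

Lemma row_norm_ge v i : `|v ord0 i| <= `|v|.
Proof.
rewrite [leRHS]/Num.Def.normr /= mx_normrE.
exact: (le_bigmax _ (fun ij : 'I_1 * 'I_d => `|v ij.1 ij.2|) (ord0, i)).
Qed.

Lemma row_norm_le v (b : R) : 0 <= b -> (forall i, `|v ord0 i| <= b) -> `|v| <= b.
Proof.
move=> b0 vb; rewrite [leLHS]/Num.Def.normr /= mx_normrE; apply: bigmax_le => // -[i j] _ /=.
by rewrite ord1.
Qed.

Lemma enorm_coord_le v i : `|v ord0 i| <= enorm v.
Proof.
rewrite /enorm -sqrtr_sqr ler_sqrt; last by apply: sumr_ge0 => j _; rewrite -expr2 sqr_ge0.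
rewrite /dotp (bigD1 i) //= -expr2 lerDl.
by apply: sumr_ge0 => j _; rewrite -expr2 sqr_ge0.
Qed.

Lemma row_norm_le_enorm v : `|v| <= enorm v.
Proof. by apply: row_norm_le => [|i]; [exact: sqrtr_ge0|exact: enorm_coord_le]. Qed.

Lemma enorm_le v (b : R) : 0 <= b -> (forall i, `|v ord0 i| <= b) -> enorm v <= d%:R * b.
Proof.
move=> b0 vb; have db0 : 0 <= d%:R * b by rewrite mulr_ge0.
rewrite -[leRHS]ger0_norm // -sqrtr_sqr ler_sqrt ?sqr_ge0 // exprMn.
apply: (@le_trans _ _ (\sum_(i < d) b ^+ 2)).
  by apply: ler_sum => i _; rewrite -expr2 -[leLHS]real_normK ?num_real // ler_sqr ?nnegrE.
rewrite sumr_const card_ord -[_ *+ d]mulr_natl ler_wpM2r ?sqr_ge0 //.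
by rewrite -natrX ler_nat; case: (d) => // e; rewrite expnS expn1 leq_pmulr.
Qed.

End Norms.

(** * The measures at scale 1/n *)

Section PlateMeasures.
Context (R : realType) (k : nat).
Local Notation K := (k.+1 * 2).+1.

Definition rad_const : R := k.+2%:R * (5 * k.+1 + 5)%N%:R.
(** [W1_const / n] is [gain_const * r / mass_const] for the bump radius
    [r = 1 / (4 * (k + 2) * n)]. *)
Definition W1_const : R := gain_const R k / (4 * (k + 2)%N%:R * mass_const R k).
Definition slice_const : R :=
  4 * (48 ^+ k.+1 + k.+1%:R * 4 ^+ k.+1 * 16) / gain_const R k.

Definition position (n M : nat) (y : 'I_k.+1 -> nat) (z : nat) : 'rV[R]_k.+2 :=
  \row_i (if unlift ord0 i is Some j then (y j)%:R / M%:R else z%:R / (n%:R * M%:R)).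

Lemma position0 n M y z : position n M y z ord0 ord0 = z%:R / (n%:R * M%:R).
Proof. by rewrite mxE unlift_none. Qed.

Lemma positionS n M y z j : position n M y z ord0 (lift ord0 j) = (y j)%:R / M%:R.
Proof. by rewrite mxE liftK. Qed.

Lemma dotp_position (theta : 'rV[R]_k.+2) n M y z :
  dotp theta (position n M y z) =
  (\sum_i theta ord0 (lift ord0 i) / M%:R * (y i)%:R) +
  theta ord0 ord0 / (n%:R * M%:R) * z%:R.
Proof.
rewrite /dotp big_ord_recl position0 addrC; congr (_ + _); last by ring.
by apply: eq_bigr => i _; rewrite positionS; ring.
Qed.

Lemma natr_dist_lt (a b l : nat) : `|a%:R - b%:R| < l%:R :> R -> (a < b + l /\ b < a + l)%N.
Proof.
rewrite ltr_norml => /andP[h1 h2]; rewrite -!(ltr_nat R) !natrD; split; lra.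
Qed.

Lemma natr_dist_ge (c a b : nat) : a != b -> c%:R <= `|(c * a)%N%:R - (c * b)%N%:R| :> R.
Proof.
rewrite neq_ltn => /orP[] ab; [rewrite distrC|];
  (rewrite -natrB; last by rewrite leq_mul2l ltnW ?orbT);
  rewrite normr_nat ler_nat -mulnBr leq_pmulr // subn_gt0 //.
Qed.

Lemma plate_measures (n : nat) (t : R) : (0 < n)%N -> 0 < t ->
  exists mu nu : probability (borel_rV R k.+2) R,
    [/\ supported_on mu (ecball (t * rad_const)), supported_on nu (ecball (t * rad_const)),
      ((t * (W1_const / n%:R))%:E <= W1 mu nu)%E &
      (max_sliced_W1 mu nu <=
        (t * (slice_const / (n%:R ^+ 2 * Num.sqrt (n%:R ^+ k))))%:E)%E].
Proof.
move=> n0 t0.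
have wid : (3 <= 5 * k.+1 + 5)%N by lia.
have hei : (3 * k.+1 * n + k.+1 * 2 + 2 <= (5 * k.+1 + 5) * n)%N by nia.
(* This power makes [M] at least [n ^ k.+2], as the rounding errors require. *)
pose lp := (n ^ k.+1)%N.
have lp0 : (0 < lp)%N by rewrite expn_gt0 n0.
pose M := thickness k n lp.
have M0 : (0 < M)%N by exact: thickness_gt0.
have MR : 0 < M%:R :> R by rewrite ltr0n.
have nR : 0 < n%:R :> R by rewrite ltr0n.
have lR : 0 < lp%:R :> R by rewrite ltr0n.
have qR : 0 < (k + 2)%N%:R :> R by rewrite ltr0n addn2.
pose r : R := (2 * lp)%N%:R / M%:R.
have r0 : 0 < r by rewrite divr_gt0 // ltr0n muln_gt0.
pose X := ({ffun 'I_k.+1 -> 'I_(width k n lp)} * 'I_(height k n lp))%type.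
pose A := ({ffun 'I_k.+1 -> 'I_(2 * (k + 2) * n)} * 'I_(height k n lp))%type.
pose J := {ffun 'I_k.+1 -> 'I_n}.
pose pos (x : X) := position n M (fun i => x.1 i) x.2.
pose ctr (a : A) := position n M (fun i => center n0 lp0 a.1 i) (centerz n lp a.2).
pose psi (a : A) (x : X) : R := spike ctr r a (pos x).
have nM0 : 0 < n%:R * M%:R :> R by rewrite mulr_gt0.
have diffS (x : X) (a : A) i : (pos x - ctr a) ord0 (lift ord0 i) =
    ((x.1 i)%:R - (center n0 lp0 a.1 i)%:R) / M%:R.
  by rewrite !mxE liftK mulrBl.
have diff0 (x : X) (a : A) : (pos x - ctr a) ord0 ord0 =
    ((x.2)%:R - (centerz n lp a.2)%:R) / (n%:R * M%:R).
  by rewrite !mxE unlift_none mulrBl.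
have rE : r = (2 * n * lp)%N%:R / (n%:R * M%:R).
  by rewrite /r !natrM; field; rewrite !gt_eqF.
have psi_bound a x : 0 <= psi a x <= r by exact: spike_bound.
have psi_supp (a : A) (x : X) : psi a x != 0 ->
    (forall i, x.1 i < center n0 lp0 a.1 i + 2 * lp /\ center n0 lp0 a.1 i < x.1 i + 2 * lp)%N /\
    (x.2 < centerz n lp a.2 + 2 * n * lp /\ centerz n lp a.2 < x.2 + 2 * n * lp)%N.
  move=> /spike_supp[_ h]; split.
    move=> i; have := le_lt_trans (row_norm_ge _ (lift ord0 i)) h.
    rewrite diffS normf_div normr_nat /r ltr_pM2r ?invr_gt0 //.
    exact: natr_dist_lt.
  have := le_lt_trans (row_norm_ge _ ord0) h.
  rewrite diff0 normf_div (gtr0_norm nM0) rE ltr_pM2r ?invr_gt0 //.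
  exact: natr_dist_lt.
have psi_core (a : A) (x : X) :
    (forall i, center n0 lp0 a.1 i <= x.1 i < center n0 lp0 a.1 i + lp)%N ->
    (centerz n lp a.2 <= x.2 < centerz n lp a.2 + n * lp)%N -> r / 2 <= psi a x.
  move=> h1 h2; apply: le_trans (spike_ge _ _ _ _).
  suff : `|pos x - ctr a| <= r / 2 by lra.
  have aux (u v l : nat) : (u <= v < u + l)%N -> `|v%:R - u%:R| <= l%:R :> R.
    case/andP=> uv vu; rewrite -natrB // normr_nat ler_nat leq_subLR.
    exact: ltnW.
  apply: row_norm_le; first by rewrite divr_ge0 // ltW.
  move=> i; case: (unliftP ord0 i) => [j ->|->].
    rewrite diffS normf_div normr_nat (_ : r / 2 = lp%:R / M%:R); last first.
      by rewrite /r natrM; field; rewrite gt_eqF.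
    by rewrite ler_pM2r ?invr_gt0 //; apply: aux.
  rewrite diff0 normf_div (gtr0_norm nM0) (_ : r / 2 = (n * lp)%N%:R / (n%:R * M%:R)); last first.
    by rewrite /r !natrM; field; rewrite !gt_eqF.
  by rewrite ler_pM2r ?invr_gt0 //; apply: aux.
have ctr_sep (a b : A) : a != b -> 2 * r <= `|ctr a - ctr b|.
  case: a b => [a1 a2] [b1 b2]; rewrite -pair_eqE negb_and => /orP[h|h].
    have [i hi] : exists i, a1 i != b1 i.
      by apply/existsP; apply: contraR h; rewrite negb_exists => /forallP H;
        apply/eqP/ffunP => i; apply/eqP; have := H i; rewrite negbK.
    apply: le_trans (row_norm_ge _ (lift ord0 i)).
    rewrite !mxE liftK !center_val -mulrBl normf_div normr_nat !natrD opprD addrACA subrr add0r.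
    have -> : 2 * r = (4 * lp)%N%:R / M%:R by rewrite /r !natrM; ring.
    by rewrite ler_pM2r ?invr_gt0 //; apply: natr_dist_ge.
  apply: le_trans (row_norm_ge _ ord0).
  rewrite !mxE unlift_none -mulrBl normf_div (gtr0_norm nM0).
  have -> : 2 * r = (4 * n * lp)%N%:R / (n%:R * M%:R) by rewrite rE !natrM; ring.
  by rewrite ler_pM2r ?invr_gt0 //; apply: natr_dist_ge.
pose N0 : R := Num.sqrt (n%:R ^+ k).
have N00 : 0 < N0 by rewrite sqrtr_gt0 exprn_gt0.
have N02 : N0 ^+ 2 = n%:R ^+ k by rewrite sqr_sqrtr // exprn_ge0 // ltW.
have [e e1 He] := @plate_signs R k n lp n0 lp0 N0 r psi N00 N02 r0 psi_bound psi_supp psi_core.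
(* With these signs on the spikes, the pairing of [f] with [phi] is the sum of absolute values that
   the random signs make large. *)
pose sg (a : A) : R := Num.sg (\sum_(b : J) e b * coef psi b a).
have sg1 a : `|sg a| <= 1 by rewrite normr_sg; case: (_ != _).
pose phi := spike_sum ctr sg r.
pose f (x : X) : R := \sum_(b : J) e b * plate R M b x.
pose B := \sum_x `|f x|.
have fphi : \sum_x f x * phi (pos x) = \sum_a `|\sum_(b : J) e b * coef psi b a|.
  transitivity (\sum_(x : X) \sum_(a : A) sg a * (f x * psi a x)).
    apply: eq_bigr => x _; rewrite /phi /spike_sum mulr_sumr; apply: eq_bigr => a _.
    by rewrite mulrCA.
  rewrite exchange_big /=; apply: eq_bigr => a _.
  rewrite -mulr_sumr normrEsg -/(sg a); congr (_ * _).
  transitivity (\sum_(x : X) \sum_(b : J) e b * (plate R M b x * psi a x)).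
    by apply: eq_bigr => x _; rewrite /f mulr_suml; apply: eq_bigr => b _; rewrite mulrA.
  by rewrite exchange_big /=; apply: eq_bigr => b _; rewrite -mulr_sumr.
rewrite -fphi in He.
have phi_bound x : `|phi x| <= r by exact: spike_sum_bound.
have fphi_le : \sum_x f x * phi (pos x) <= r * B.
  rewrite /B mulr_sumr; apply: ler_sum => x _; apply: le_trans (ler_norm _) _.
  by rewrite normrM mulrC ler_wpM2r.
have g0 := gain_const_gt0 R k; have m0 := mass_const_gt0 R k.
have W0 : 0 < n%:R * N0 * M%:R ^+ K.
  by apply: mulr_gt0 (mulr_gt0 nR N00) _; exact: exprn_gt0.
have B0' : 0 <= B by apply: sumr_ge0.
(* Since [|phi| <= r], the pairing is at most [r * B], so the first term of [He] bounds the total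
   variation from below. The second term serves for [W1]. *)
have B_ge : gain_const R k * (n%:R * N0 * M%:R ^+ K) / 2 <= B.
  rewrite -(ler_pM2l r0); apply: le_trans fphi_le; apply: le_trans He.
  rewrite (_ : r * _ = gain_const R k * r * (n%:R * N0 * M%:R ^+ K) / 2); last by ring.
  rewrite lerDl; apply: mulr_ge0 => //.
  by apply: divr_ge0; [exact: ltW (mulr_gt0 g0 r0)|rewrite mulr_ge0 // ltW].
have B0 : 0 < B by apply: lt_le_trans B_ge; rewrite divr_gt0 // mulr_gt0.
pose cst : R := 48 ^+ k.+1 + k.+1%:R * 4 ^+ k.+1 * 16.
pose S : R := M%:R ^+ K * (cst / n%:R).
have slices (th : 'I_k.+1 -> R) (th0 : R) g : (forall u v, `|g u - g v| <= `|u - v|) ->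
    (forall i, `|th i| <= 1) -> `|th0| <= 1 ->
    \sum_(x : X) f x * g ((\sum_i th i / M%:R * (x.1 i)%:R) + th0 / (n%:R * M%:R) * x.2%:R) <= S.
  move=> gl thi th01.
  have nM : (n ^ k.+2 <= M)%N.
    rewrite /M /thickness /lp expnS -[leqLHS]mul1n mulnA; apply: leq_mul => //.
    by apply: leq_mul => //; rewrite muln_gt0 addn2.
  have := @sum_slice_plate_le R k.+1 n M (width k n lp) (height k n lp) th th0 g n0 nM (leqnn _)
    (@dotn_height k n lp n0 lp0) gl thi th01.
  apply: le_trans.
  rewrite (eq_bigr (fun x : X => \sum_(b : J) e b * (plate R M b x *
    g ((\sum_i th i / M%:R * (x.1 i)%:R) + th0 / (n%:R * M%:R) * x.2%:R)))); last first.
    by move=> x _; rewrite /f mulr_suml; apply: eq_bigr => b _; rewrite mulrA.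
  rewrite exchange_big /=; apply: ler_sum => b _; rewrite -mulr_sumr.
  by apply: le_trans (ler_norm _) _; rewrite normrM ler_piMl.
(* Constants are admissible in [slices], which bounds every multiple of the total mass by [S]; hence
   the mass is 0. *)
have f0 : \sum_x f x = 0.
  apply/eqP; apply: contraT => fn0.
  have := @slices (fun=> 0) 0 (fun=> (S + 1) / \sum_x f x).
  rewrite -mulr_suml mulrCA divff // mulr1.
  move=> H; suff : S + 1 <= S by rewrite gerDl ler10.
  by apply: H => [u v|i|]; rewrite ?subrr normr0.
have pos_le (x : X) : enorm (pos x) <= rad_const.
  apply: enorm_le => // i; case: (unliftP ord0 i) => [j ->|->].
    rewrite positionS normf_div !normr_nat ler_pdivrMr // -natrM ler_nat.
    exact: leq_trans (ltnW (ltn_ord _)) (leq_mul wid (leqnn M)).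
  rewrite position0 normf_div (gtr0_norm nM0) normr_nat ler_pdivrMr // -!natrM ler_nat.
  by rewrite mulnA; exact: leq_trans (ltnW (ltn_ord _)) (leq_mul hei (leqnn M)).
have dual theta : esphere theta -> forall g : R -> R,
    (forall u v, `|g u - g v| <= `|u - v|) ->
    \sum_x f x * g (dotp theta (pos x)) <= S.
  move=> th1 g gl; have th1' : enorm theta = 1 by exact: th1.
  under eq_bigr do rewrite dotp_position.
  by apply: (@slices (fun i => theta ord0 (lift ord0 i)) (theta ord0 ord0) g gl) => [i|];
    rewrite -th1' enorm_coord_le.
have phi_lip x y : `|phi x - phi y| <= enorm (x - y).
  by apply: le_trans (row_norm_le_enorm _); exact: spike_sum_lip.
have phi_cont : continuous phi by exact: spike_sum_continuous.
have [mu [nu [H1 H2 H3 H4]]] :=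
  scaled_measures_of_signed_weights t0 pos_le f0 B0 phi_cont phi_bound phi_lip dual.
exists mu, nu; split=> //.
  apply: le_trans H3; rewrite lee_fin ler_pM2l // -/B.
  rewrite ler_pdivlMr //.
  have : gain_const R k * r / (2 * mass_const R k) * B <= \sum_x f x * phi (pos x).
    apply: le_trans He; rewrite lerDr divr_ge0 // ltW //.
    exact: mulr_gt0 (mulr_gt0 g0 r0) W0.
  have -> : W1_const / n%:R * B = 2 * (gain_const R k * r / (2 * mass_const R k) * B).
    rewrite /W1_const /r /M /thickness !natrM natrD; field.
    rewrite -natrD !gt_eqF //=.
  lra.
apply: (le_trans H4); rewrite lee_fin ler_pM2l // -/B ler_pdivrMr //.
(* Here [M ^ K] cancels: slices of order [M ^ K / n] are divided by a total variation of order
   [n * N0 * M ^ K]. *)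
apply: (@le_trans _ _ (slice_const / (n%:R ^+ 2 * N0) * (gain_const R k * (n%:R * N0 * M%:R ^+ K) / 2))).
  rewrite le_eqVlt; apply/orP; left; apply/eqP; rewrite /S /slice_const -/cst.
  move: (M%:R ^+ K) => MK; field; by rewrite !gt_eqF.
apply: ler_wpM2l => //; apply: divr_ge0; last by rewrite mulr_ge0 ?exprn_ge0 // ltW.
apply: divr_ge0; last exact: ltW.
by rewrite mulr_ge0 // addr_ge0 ?mulr_ge0 ?exprn_ge0.
Qed.

End PlateMeasures.

(** * Choice of the scale, and the bound on the exponent *)

Lemma sqr_mul_sqrt_powR (R : realType) (x : R) (k : nat) : 0 < x ->
  x `^ (1 + k.+2%:R / 2%:R) = x ^+ 2 * Num.sqrt (x ^+ k).
Proof.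
move=> x0; have -> : 1 + k.+2%:R / 2%:R = 2%:R + k%:R / 2%:R :> R.
  by rewrite -addn2 natrD; field.
rewrite powRD ?(gt_eqF x0) ?implybT // powR_mulrn ?ltW //; congr (_ * _).
by rewrite powRrM powR_mulrn ?ltW // powR12_sqrt // exprn_ge0 // ltW.
Qed.

(** The radius is arbitrary because the bound on the exponent is needed on balls of every radius;
    the dilation [t] affects only the constants. *)
Lemma small_slices_measures (R : realType) (k : nat) (r : R) : 0 < r ->
  exists C rho_d : R, [/\ 0 < C, 0 < rho_d &
    forall rho : R, 0 < rho -> rho <= rho_d ->
    exists mu nu : probability (borel_rV R k.+2) R,
      [/\ supported_on mu (ecball r), supported_on nu (ecball r),
          (rho%:E <= W1 mu nu)%E &
          (max_sliced_W1 mu nu <= (C * rho `^ (1 + k.+2%:R / 2%:R))%:E)%E]].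
Proof.
move=> r0; set p := 1 + _.
have rad0 : 0 < rad_const R k by rewrite /rad_const mulr_gt0 // ltr0n addn_gt0 orbT.
have g0 := gain_const_gt0 R k; have m0 := mass_const_gt0 R k.
pose t := r / rad_const R k.
have t0 : 0 < t by rewrite divr_gt0.
have tr : t * rad_const R k = r by rewrite /t divfK // gt_eqF.
pose c1 := t * W1_const R k; pose c2 := t * slice_const R k.
have q0' : 0 < (k + 2)%:R :> R by rewrite ltr0n addn2.
have c10 : 0 < c1.
  apply: mulr_gt0 t0 _; rewrite /W1_const; apply: divr_gt0 g0 _.
  exact: mulr_gt0 (mulr_gt0 (ltr0Sn _ _) q0') m0.
have c20 : 0 < c2.
  apply: mulr_gt0 t0 _; rewrite /slice_const; apply: divr_gt0 _ g0.
  apply: mulr_gt0 (ltr0Sn _ _) _; apply: ltr_wpDr; last exact: exprn_gt0.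
  by rewrite mulr_ge0 // mulr_ge0 // exprn_ge0.
have c1E : t * W1_const R k = c1 by [].
have c2E : t * slice_const R k = c2 by [].
clearbody c1 c2; exists (c2 * (2 / c1) `^ p), c1; split => //.
  by rewrite mulr_gt0 // powR_gt0 // divr_gt0.
move=> rho rho0 rhoc.
have q1 : 1 <= c1 / rho by rewrite ler_pdivlMr // mul1r.
have q0 : 0 <= c1 / rho by rewrite (le_trans ler01).
(* The largest [n] with [rho <= c1 / n]. As [c1 / rho >= 1], it is at least [c1 / (2 * rho)], whence
   the factor [(2 / c1) ^ p] in the constant. *)
pose n := Num.truncn (c1 / rho).
have /andP[n1 n2] : n%:R <= c1 / rho < n.+1%:R by apply: truncn_itv.
have n0 : (0 < n)%N.
  by rewrite -ltnS -(ltr_nat R); apply: le_lt_trans n2.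
have nR : 1 <= n%:R :> R by rewrite ler1n.
have [mu [nu [H1 H2 H3 H4]]] := @plate_measures R k n t n0 t0.
rewrite tr in H1 H2.
exists mu, nu; split=> //.
  apply: le_trans H3; rewrite lee_fin mulrA c1E ler_pdivlMr ?ltr0n //.
  by rewrite mulrC -ler_pdivlMr.
apply: (le_trans H4); rewrite lee_fin mulrA c2E -mulrA ler_pM2l //.
have x0 : 0 < c1 / (2 * rho) by rewrite divr_gt0 // mulr_gt0.
have xn : c1 / (2 * rho) <= n%:R.
  rewrite invfM mulrCA -[leRHS](mulfVK (_ : 2 != 0 :> R)) // mulrC.
  have : n.+1%:R = n%:R + 1 :> R by rewrite natr1.
  move=> e; rewrite e in n2; lra.
rewrite -sqr_mul_sqrt_powR ?ltr0n // -/p.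
have e : (2 / c1) `^ p * rho `^ p * (c1 / (2 * rho)) `^ p = 1.
  rewrite -!powRM ?mulr_ge0 ?divr_ge0 ?invr_ge0 ?mulr_ge0 ?(ltW c10) ?(ltW rho0) //.
  by rewrite (_ : _ * _ = 1) ?powR1 //; field; rewrite !gt_eqF.
have -> : (2 / c1) `^ p * rho `^ p = ((c1 / (2 * rho)) `^ p)^-1.
  by apply: (mulIf (lt0r_neq0 (powR_gt0 p x0))); rewrite e mulVf // gt_eqF // powR_gt0.
rewrite lef_pV2 ?posrE ?powR_gt0 ?ltr0n //.
apply: ge0_ler_powR => //; rewrite ?nnegrE ?(ltW x0) //.
by rewrite addr_ge0 // divr_ge0.
Qed.

Lemma W1_line_ge0 (R : realType) (mu nu : probability R R) : (0 <= W1_line mu nu)%E.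
Proof.
apply: le_ereal_inf_tmp => _ [gam _ <-].
by apply: integral_ge0 => z _; rewrite lee_fin.
Qed.

(** Dimension at least 1 provides a unit vector; a supremum over an empty sphere would be [-oo].
    Nonnegativity is used for the monotonicity of the power [beta]. *)
Lemma max_sliced_W1_ge0 (R : realType) (k : nat)
    (mu nu : probability (borel_rV R k.+1) R) : (0 <= max_sliced_W1 mu nu)%E.
Proof.
pose theta : 'rV[R]_k.+1 := delta_mx ord0 ord0.
have th1 : esphere theta.
  rewrite /esphere /= /enorm /dotp (bigD1 ord0) //= big1 ?addr0.
    by rewrite mxE !eqxx mulr1 sqrtr1.
  by move=> i i0; rewrite mxE (negbTE i0) andbF mulr0.
apply: (le_trans (@W1_line_ge0 R (distribution mu (slice theta)) (distribution nu (slice theta)))).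
by apply: ereal_sup_ubound; exists theta.
Qed.

Theorem theorem1p1 (R : realType) (d : nat) (hd : (2 <= d)%N) :
  (exists C rho_d : R, [/\ 0 < C, 0 < rho_d &
    forall rho : R, 0 < rho -> rho <= rho_d ->
    exists mu nu : probability (borel_rV R d) R,
      [/\ supported_on mu (ecball 1), supported_on nu (ecball 1),
          (rho%:E <= W1 mu nu)%E &
          (max_sliced_W1 mu nu <= (C * rho `^ (1 + d%:R / 2%:R))%:E)%E]]) /\
  (forall r beta C' : R, 0 < r -> 0 < beta ->
    (forall mu nu : probability (borel_rV R d) R,
       supported_on mu (ecball r) -> supported_on nu (ecball r) ->
       (W1 mu nu <= C'%:E * max_sliced_W1 mu nu `^ beta)%E) ->
    beta <= 2%:R / (d%:R + 2%:R)).
Proof.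
case: d hd => [|[|k]] // _; split; first exact: small_slices_measures.
move=> r beta C' r0 beta0 H; rewrite leNgt; apply/negP => Hbeta.
have [C [rho_d [C0 rho_d0 Hrho]]] := @small_slices_measures R k r r0.
set p := 1 + _ in Hrho.
have d2 : 0 < k.+2%:R + 2%:R :> R by rewrite addr_gt0 // ltr0n.
have p0 : 0 < p by rewrite /p ltr_wpDr // divr_ge0.
(* [1 / p = 2 / (d + 2)], so a larger [beta] makes [s] positive, and the assumed inequality becomes
   [1 <= D * rho ^ s] for all small [rho]. *)
pose s := p * beta - 1.
have s0 : 0 < s.
  rewrite subr_gt0; rewrite ltr_pdivrMr // in Hbeta.
  have : beta * (k.+2%:R + 2) = 2 * (p * beta) by rewrite /p; field.
  by move=> e; rewrite e in Hbeta; lra.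
(* The absolute value covers a constant of either sign. *)
pose D := `|C'| * C `^ beta.
have D0 : 0 <= D by rewrite mulr_ge0 // powR_ge0.
have key rho : 0 < rho -> rho <= rho_d -> 1 <= D * rho `^ s.
  move=> rho0 rhod; have [mu [nu [H1 H2 H3 H4]]] := Hrho rho rho0 rhod.
  have m0 := max_sliced_W1_ge0 mu nu.
  have CR0 : 0 <= C * rho `^ p by rewrite mulr_ge0 ?powR_ge0 ?ltW.
  have P : (max_sliced_W1 mu nu `^ beta <= ((C * rho `^ p) `^ beta)%:E)%E.
    rewrite -poweR_EFin; apply: gt0_ler_poweR => //; first exact: ltW.
      by rewrite in_itv /= m0 leey.
    by rewrite in_itv /= lee_fin CR0 leey.
  have : (rho%:E <= (`|C'| * (C * rho `^ p) `^ beta)%:E)%E.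
    apply: (le_trans H3); apply: (le_trans (H _ _ H1 H2)).
    apply: (@le_trans _ _ (`|C'|%:E * max_sliced_W1 mu nu `^ beta)%E).
      by apply: lee_wpmul2r; rewrite ?poweR_ge0 // lee_fin ler_norm.
    by rewrite EFinM; apply: lee_wpmul2l => //; rewrite lee_fin.
  rewrite lee_fin powRM ?powR_ge0 ?(ltW C0) // -powRrM.
  have -> : p * beta = 1 + s by rewrite /s addrC subrK.
  rewrite powRD ?(gt_eqF rho0) ?implybT // powRr1 ?(ltW rho0) //.
  rewrite [rho * _]mulrC !mulrA -/D -[leLHS]mul1r.
  by rewrite ler_pM2r.
(* This forces [rho ^ s <= 1 / (D + 1)], hence [D * rho ^ s < 1]. *)
pose rho := Num.min rho_d ((D + 1)^-1 `^ s^-1).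
have D1 : 0 < D + 1 by rewrite ltr_wpDl.
have rho0 : 0 < rho by rewrite lt_min rho_d0 powR_gt0 // invr_gt0.
have := key rho rho0; rewrite ge_min lexx => /(_ isT).
suff : D * rho `^ s < 1 by rewrite ltNge => /negP h /h.
have h1 : rho `^ s <= (D + 1)^-1.
  apply: (@le_trans _ _ (((D + 1)^-1 `^ s^-1) `^ s)).
    by apply: ge0_ler_powR; rewrite ?nnegrE ?powR_ge0 ?(ltW s0) ?(ltW rho0) // ge_min lexx orbT.
  by rewrite -powRrM mulVf ?gt_eqF // powRr1 // invr_ge0 ltW.
apply: (le_lt_trans (ler_wpM2l D0 h1)).
by rewrite ltr_pdivrMr // mul1r ltrDl.
Qed.
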